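(* Let $1\le p\le 2$ and let $\mathcal{X}$ be a real separable Banach space with norm $\|\cdot\|$. Then the following statements are equivalent: (i) $\mathcal{X}$ is of Rademacher type $p$. (ii) For every double array $\{V_{mn}, m\ge 1, n\ge 1\}$ of independent mean $0$ random elements in $\mathcal{X}$, writing $S_{mn}=\sum_{i=1}^m\sum_{j=1}^n V_{ij}$, the condition $$\sum_{m=1}^\infty\sum_{n=1}^\infty \frac{E\|V_{mn}\|^p}{m^p n^p}<\infty$$ implies $$\sum_{m=1}^\infty\sum_{n=1}^\infty E\left\|\frac{S_{mn}}{(mn)^{(p+1)/p}}\right\|^p<\infty,$$ i.e. $S_{mn}/(mn)^{(p+1)/p}$ converges completely to $0$ in mean of order $p$.
   Context: The expected value (mean) of a Banach-space-valued random element is its Pettis integral; ''mean $0$'' means this expected value exists and equals $0$. A real separable Banach space is of Rademacher type $p$ ($1\le p\le 2$) if there is a constant $C$ such that $E\|\sum_{j=1}^n \varepsilon_j x_j\|^p\le C\sum_{j=1}^n\|x_j\|^p$ for all finite collections $x_1,\dots,x_n\in\mathcal{X}$, where $\varepsilon_1,\dots,\varepsilon_n$ are independent Rademacher (symmetric $\pm1$-valued) random variables. A double array $\{T_{mn}\}$ of random elements is said to converge completely to $0$ in mean of order $p$ if $\sum_{m\ge1}\sum_{n\ge1}E\|T_{mn}\|^p<\infty$. *)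

(* Defs.v *)
From HB Require Import structures.
From mathcomp Require Import all_boot all_order all_algebra.
From mathcomp Require Import all_classical all_reals all_analysis.
Set Implicit Arguments. Unset Strict Implicit. Unset Printing Implicit Defensive.
Import Order.TTheory GRing.Theory Num.Theory.
Import numFieldNormedType.Exports.
Local Open Scope classical_set_scope.
Local Open Scope ring_scope.

Section Defs.
Variable R : realType.

Definition separable (X : normedModType R) : Prop :=
  exists D : set X, countable D /\ dense D.

(* Rademacher type p: E || sum_j eps_j x_j ||^p <= C sum_j ||x_j||^p,
   the expectation over n independent Rademacher signs written out as the
   uniform average over all 2^n sign patterns (true = +1, false = -1). *)
Definition rsign (b : bool) : R := if b then 1 else -1.

Definition rademacher_type (X : normedModType R) (p : R) : Prop :=
  exists C : R, forall (n : nat) (x : 'I_n -> X),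
    (2%:R ^- n) * \sum_(e : {ffun 'I_n -> bool})
        (`| \sum_(j < n) rsign (e j) *: x j | `^ p)
    <= C * \sum_(j < n) (`| x j | `^ p).

Definition dual_elem (X : normedModType R) (f : X -> R) : Prop :=
  (forall (a : R) (x y : X), f (a *: x + y) = a * f x + f y) /\ continuous f.

Variables (d : measure_display) (T : measurableType d) (P : probability T R).

Definition random_element (X : normedModType R) (V : T -> X) : Prop :=
  forall B : set X, <<s open >> B -> measurable (V @^-1` B).

Definition pettis_mean (X : normedModType R) (V : T -> X) (x : X) : Prop :=
  (forall f : X -> R, dual_elem f -> P.-integrable setT (EFin \o (f \o V))) /\
  (forall A : set T, measurable A -> exists xA : X,
     forall f : X -> R, dual_elem f ->
       (\int[P]_(w in A) (f (V w))%:E = (f xA)%:E)%E) /\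
  (forall f : X -> R, dual_elem f -> (\int[P]_w (f (V w))%:E = (f x)%:E)%E).

Definition mean_zero (X : normedModType R) (V : T -> X) : Prop :=
  pettis_mean V 0.

Definition independent (I : eqType) (X : normedModType R) (V : I -> T -> X) : Prop :=
  forall (s : seq I) (B : I -> set X), uniq s ->
    (forall i, i \in s -> <<s open >> (B i)) ->
    P (\bigcap_(i in [set i | i \in s]) (V i @^-1` B i)) =
      (\prod_(i <- s) P (V i @^-1` B i))%E.

Definition pmoment (X : normedModType R) (p : R) (Y : T -> X) : \bar R :=
  (\int[P]_w (`| Y w | `^ p)%:E)%E.

End Defs.

(* Main.v *)
Require Import Defs.
From HB Require Import structures.
From mathcomp Require Import all_boot all_order all_algebra.
From mathcomp Require Import all_classical all_reals all_analysis.
From mathcomp Require Import measurable_realfun lra ring zify.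
Import Order.TTheory GRing.Theory Num.Theory.
Import numFieldNormedType.Exports.
Local Open Scope classical_set_scope.
Local Open Scope ring_scope.
Set Implicit Arguments. Unset Strict Implicit. Unset Printing Implicit Defensive.

(** (i) => (ii).  Hahn-Banach gives a functional norming the value of a centered sum S,
    hence E |S|^p <= E |S - S'|^p for an independent copy S'.  The differences
    V_ij - V'_ij are symmetric and independent, so random signs may be inserted and
    the type-p inequality yields E |S_mn|^p <= K * sum_(i <= m, j <= n) E |V_ij|^p.
    Two Abel summations, based on sum_(m >= i) m^-(p+1) = O(i^-p), conclude.

    (ii) => (i).  If X is not of type p, choose for every k a finite sequence violating
    the type inequality with constant 4^k, scale its p-th power sum to 2^-k N_k^p,
    and place it, with Rademacher signs, at the positions just after N_k of a single
    column, where N_(k+1) >= 4 N_k.  The hypothesis of (ii) holds, with sum at most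
    sum_k 2^-k.  The column sums are constant on the windows [N_k/2, N_k] and
    [2 N_k, 4 N_k), so the convergence in (ii) bounds the p-th moment of the k-th
    block by O(N_k^p), whereas by construction it exceeds 2^k N_k^p. *)

(** * Norming functionals *)

Section HahnBanach.
Context {R : realType} {X : normedModType R}.

Definition sublinear (q : X -> R) : Prop :=
  (forall x y, q (x + y) <= q x + q y) /\
  (forall t x, 0 <= t -> q (t *: x) = t * q x).

Definition dominated_sublinear (q : X -> R) : Prop :=
  sublinear q /\ forall x, q x <= `|x|.

Lemma sublinear0 q : sublinear q -> q 0 = 0.
Proof. by move=> [_ /(_ 0 0 (lexx _))]; rewrite scale0r mul0r. Qed.

Lemma sublinear_ge_opp q x : sublinear q -> - q (- x) <= q x.
Proof.
move=> qs; have [qD _] := qs.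
by rewrite lerNl -subr_ge0 opprK addrC -(sublinear0 qs) -(subrr x) qD.
Qed.

Lemma dominated_sublinear_norm : dominated_sublinear (fun x => `|x|).
Proof.
split=> //; split=> [x y|t x t0]; first exact: ler_normD.
by rewrite normrZ ger0_norm.
Qed.

Definition tilt_set (q : X -> R) (z x : X) : set R :=
  [set q (x + t *: z) - t * q z | t in [set t | 0 <= t]].

(* The largest sublinear functional below q that is linear along the ray of z;
   it is both the starting point and the descent step of the Zorn argument. *)
Definition tilt (q : X -> R) (z x : X) : R := inf (tilt_set q z x).

Lemma tilt_set_lb q z x : sublinear q -> lbound (tilt_set q z x) (- q (- x)).
Proof.
move=> [qD qZ] _ [t t0 <-].
have := qD (- x) (x + t *: z); rewrite addrA addNr add0r qZ //.
by lra.
Qed.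

Lemma tilt_le_point q z x t : sublinear q -> 0 <= t ->
  tilt q z x <= q (x + t *: z) - t * q z.
Proof.
move=> qs t0; apply: ge_inf; last by exists t.
by exists (- q (- x)); exact: tilt_set_lb.
Qed.

Lemma tilt_set_neq0 q z x : tilt_set q z x !=set0.
Proof. by exists (q (x + 0 *: z) - 0 * q z); exists 0 => /=. Qed.

Lemma tilt_le q z x : sublinear q -> tilt q z x <= q x.
Proof.
by move=> qs; have := tilt_le_point z x qs (lexx 0); rewrite scale0r addr0 mul0r subr0.
Qed.

(** Shifts [s] for [x] and [t] for [y] combine into the shift [s + t] for [x + y], and scaling by
    [t] maps the shift [s] of [x] to the shift [t * s] of [t *: x]. *)
Lemma tilt_sublinear q z : sublinear q -> sublinear (tilt q z).
Proof.
move=> qs; have [qD qZ] := qs; split=> [x y|t x].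
  rewrite -lerBlDr; apply: lb_le_inf; first exact: tilt_set_neq0.
  move=> _ [s s0 <-]; rewrite lerBlDr -lerBlDl.
  apply: lb_le_inf; first exact: tilt_set_neq0.
  move=> _ [t t0 <-]; rewrite lerBlDr.
  apply: le_trans (tilt_le_point z (x + y) qs (addr_ge0 s0 t0)) _.
  rewrite scalerDl addrACA mulrDl.
  by have := qD (x + s *: z) (y + t *: z); lra.
rewrite le_eqVlt => /predU1P[<-|t0].
  rewrite scale0r mul0r; apply/eqP; rewrite eq_le.
  have := tilt_le z 0 qs; rewrite (sublinear0 qs) => -> /=.
  apply: lb_le_inf; first exact: tilt_set_neq0.
  by move=> r /(tilt_set_lb qs); rewrite oppr0 (sublinear0 qs) oppr0 => r0.
apply/eqP; rewrite eq_le; apply/andP; split.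
  rewrite -ler_pdivrMl //; apply: lb_le_inf; first exact: tilt_set_neq0.
  move=> _ [s s0 <-]; rewrite ler_pdivrMl //.
  apply: le_trans (tilt_le_point z _ qs (mulr_ge0 (ltW t0) s0)) _.
  by rewrite -scalerA -scalerDr (qZ _ _ (ltW t0)) mulrBr mulrA.
apply: lb_le_inf; first exact: tilt_set_neq0.
move=> _ [s s0 <-]; rewrite -ler_pdivlMl //.
have it0 : 0 <= t^-1 by rewrite invr_ge0 ltW.
have ts0 : 0 <= t^-1 * s by rewrite mulr_ge0.
apply: le_trans (tilt_le_point z _ qs ts0) _.
rewrite mulrBr mulrA -(qZ _ _ it0) scalerDr !scalerA mulVf ?gt_eqF//.
by rewrite scale1r.
Qed.


(** Zorn's lemma below [q]. The lower bound of a nonempty chain is its pointwise infimum, which is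
    finite because a dominated sublinear [r] satisfies [r x >= - r (- x) >= - |x|]. *)
Lemma minimal_sublinear (q : X -> R) : dominated_sublinear q ->
  exists2 f, dominated_sublinear f &
    (forall x, f x <= q x) /\
    (forall g, dominated_sublinear g -> (forall x, g x <= f x) -> g = f).
Proof.
move=> qd.
pose T := {r : X -> R | dominated_sublinear r /\ forall x, r x <= q x}.
(* The order is reversed, so that a maximal element for Zorn is a minimal functional. *)
pose ge (r s : T) := `[< forall x, sval s x <= sval r x >].
have chain (A : set T) : total_on A (fun x y => ge x y) ->
    exists t : T, forall s, A s -> ge s t.
  move=> Atot; have [[r0 Ar0]|A0] := pselect (A !=set0); last first.
    by exists (exist _ q (conj qd (fun x => lexx _)) : T) => s As; case: A0; exists s.
  pose S x := [set sval r x | r in A].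
  have S0 x : S x !=set0 by exists (sval r0 x); exists r0.
  have Slb x : lbound (S x) (- `|x|).
    move=> _ [[r [[rs rn] rq]] _ <-] /=.
    by apply: le_trans (sublinear_ge_opp _ rs); rewrite lerN2 -(normrN x).
  have infS r x : A r -> inf (S x) <= sval r x.
    by move=> Ar; apply: ge_inf; [exists (- `|x|)|exists r].
  have infs : sublinear (fun x => inf (S x)).
    split=> [x y|t x].
      rewrite -lerBlDr; apply: lb_le_inf => // _ [r Ar <-].
      rewrite lerBlDr -lerBlDl; apply: lb_le_inf => // _ [s As <-].
      rewrite lerBlDr; have [/asboolP rs|/asboolP sr] := Atot _ _ Ar As.
        apply: le_trans (infS s _ As) _; have [[[sD _] _] _] := svalP s.
        by have := sD x y; have := rs x; have := rs y; lra.
      apply: le_trans (infS r _ Ar) _; have [[[rD _] _] _] := svalP r.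
      by have := rD x y; have := sr x; have := sr y; lra.
    rewrite le_eqVlt => /predU1P[<-|t0].
      rewrite scale0r mul0r; apply/eqP; rewrite eq_le.
      have [[rs _] _] := svalP r0.
      rewrite -{1}(sublinear0 rs) infS //=; apply: lb_le_inf => // _ [r _ <-].
      by have [[/sublinear0 -> _] _] := svalP r.
    apply/eqP; rewrite eq_le; apply/andP; split.
      rewrite -ler_pdivrMl //; apply: lb_le_inf => // _ [r Ar <-].
      rewrite ler_pdivrMl //; have [[[_ rZ] _] _] := svalP r.
      by rewrite -(rZ _ _ (ltW t0)) infS.
    apply: lb_le_inf => // _ [r Ar <-]; have [[[_ rZ] _] _] := svalP r.
    by rewrite (rZ _ _ (ltW t0)) ler_pM2l// infS.
  have [[_ r0n] r0q] := svalP r0.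
  have infd : dominated_sublinear (fun x => inf (S x)) /\
      forall x, inf (S x) <= q x.
    by split; [split=> // x|move=> x]; apply: le_trans (infS r0 _ Ar0) _.
  exists (exist _ (fun x => inf (S x)) infd : T) => s As; by apply/asboolP => x; exact: infS.
have [|||[f [fd fq]] fmin] := @Zorn T ge _ _ _ chain.
- by move=> r; apply/asboolP.
- move=> r s t /asboolP rs /asboolP st; apply/asboolP => x.
  exact: le_trans (st x) (rs x).
- move=> [r rp] [s sp] /asboolP /= rs /asboolP /= sr; apply: eq_exist.
  by apply/funext => x; apply/eqP; rewrite eq_le rs sr.
exists f => //; split=> // g gd gf.
have gq : dominated_sublinear g /\ forall x, g x <= q x.
  by split=> // x; exact: le_trans (gf x) (fq x).
by have /(congr1 sval) := fmin (exist _ g gq : T) (introT (asboolP _) gf).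
Qed.

(** A minimal functional below the norm tilted along [x0] is unchanged by every further tilt, and
    this makes it linear. The initial tilt forces the value at [x0]. *)
Lemma norming_functional (x0 : X) : exists f : X -> R,
  [/\ dual_elem f, (forall x, f x <= `|x|) & f x0 = `|x0|].
Proof.
pose q := tilt (fun x : X => `|x|) x0.
have [ns nn] := dominated_sublinear_norm.
have qd : dominated_sublinear q.
  by split=> [|x]; [exact: tilt_sublinear|exact: tilt_le].
have [f [fs fn] [fq fmin]] := minimal_sublinear qd.
have f_tilt z : tilt f z = f.
  apply: fmin => [|x]; last exact: tilt_le.
  by split=> [|x]; [exact: tilt_sublinear|exact: le_trans (tilt_le _ _ fs) _].
have [fD fZ] := fs.
have fDE x y : f (x + y) = f x + f y.
  apply/eqP; rewrite eq_le fD /=.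
  (* Since [tilt f y = f], the shift by one copy of [y] gives superadditivity. *)
  have := tilt_le_point y x fs (@ler01 R).
  by rewrite f_tilt scale1r mul1r lerBrDr.
have fN x : f (- x) = - f x.
  by apply/eqP; rewrite -addr_eq0 -fDE addNr sublinear0.
have fE a x : f (a *: x) = a * f x.
  have [a0|a0] := leP 0 a; first exact: fZ.
  by rewrite -[a]opprK scaleNr fN fZ ?oppr_ge0 ?ltW// !mulNr.
exists f; split=> //.
  split=> [a x y|]; first by rewrite fDE fE.
  move=> x; apply/cvgrPdist_le => e e0; near=> y.
  rewrite -fN -fDE; apply: le_trans (_ : `|x - y| <= e).
    by rewrite ler_norml fn lerNl -fN opprB -normrN opprB fn.
  by near: y; exact: cvgr_dist_le.
(* The shift by [x0] at the point [- x0] gives [q (- x0) <= - |x0|], hence [f x0 >= |x0|]. *)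
apply/eqP; rewrite eq_le fn /=.
have := fq (- x0); rewrite fN lerNl => /(le_trans _); apply; rewrite lerNr.
have := tilt_le_point x0 (- x0) ns (@ler01 R).
by rewrite scale1r addNr normr0 mul1r sub0r.
Unshelve. all: by end_near. Qed.

End HahnBanach.

(** * Random elements of a separable space *)

Section RandomElements.
Context {R : realType} {X : normedModType R} {d : measure_display}
  {T : measurableType d}.
Implicit Types U V : T -> X.

Lemma random_element_open V :
  (forall O : set X, open O -> measurable (V @^-1` O)) -> random_element V.
Proof.
move=> mV B sB.
have : measurable_fun [set: T] (V : T -> g_sigma_algebraType (@open X)).
  apply: (@measurability _ _ _ (g_sigma_algebraType (@open X)) _ _ (@open X)).
    by [].
  move=> _ [A oA <-].
  by rewrite setTI; exact: mV.
by move=> /(_ measurableT B sB); rewrite setTI.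
Qed.

Lemma measurable_preimage_open V (O : set X) :
  random_element V -> open O -> measurable (V @^-1` O).
Proof. by move=> mV oO; apply: mV; exact: sub_sigma_algebra. Qed.

Lemma random_element_continuous (g : X -> X) V :
  continuous g -> random_element V -> random_element (g \o V).
Proof.
move=> /continuousP gc mV; apply: random_element_open => O oO.
by rewrite comp_preimage; apply: measurable_preimage_open => //; exact: gc.
Qed.

Lemma measurable_continuous_random_element (g : X -> R) V :
  continuous g -> random_element V -> measurable_fun [set: T] (g \o V).
Proof.
move=> /continuousP gc mV.
apply: (measurability _ (measurable_realfun.RGenOpens.measurableE R)).
move=> _ [_ [a [b ->]] <-].
rewrite setTI comp_preimage; apply: measurable_preimage_open => //.
by apply: gc; exact: interval_open.
Qed.

Lemma random_elementZ (c : R) V :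
  random_element V -> random_element (fun w => c *: V w).
Proof. by apply: random_element_continuous => x; exact: scaler_continuous. Qed.

Lemma random_elementN V :
  random_element V -> random_element (fun w => - V w).
Proof. by apply: random_element_continuous => x; exact: opp_continuous. Qed.

Lemma random_element_cst (x : X) : random_element (fun _ : T => x).
Proof.
apply: random_element_open => O _.
by have [xO|xO] := pselect (O x); [rewrite preimage_cst mem_set|
   rewrite preimage_cst memNset].
Qed.

Lemma separable_seq : separable X ->
  exists e : nat -> X, forall x r, 0 < r -> exists n, ball x r (e n).
Proof.
move=> [D [/countable_injP[f finj] dD]].
exists (fun n => xget 0 [set q | D q /\ f q = n]) => x r r0.
have [|q [xq Dq]] := dD (ball x r) _ (ball_open x r).
  by exists x; exact: ballxx.
exists (f q); case: xgetP => [y -> [Dy fy]|/(_ q)]; last by case.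
by have /= -> := finj _ _ (mem_set Dy) (mem_set Dq) fy.
Qed.

(** Separability turns the preimage of an open set under addition into a countable union of events
    that place [U] and [V] in balls around points of a dense sequence. *)
Lemma random_elementD U V : separable X ->
  random_element U -> random_element V -> random_element (fun w => U w + V w).
Proof.
move=> /separable_seq[e edense] mU mV; apply: random_element_open => O oO.
pose B n k := ball (e n) k.+1%:R^-1.
pose good (i : nat * nat * nat) :=
  forall y z, B i.1.1 i.2 y -> B i.1.2 i.2 z -> O (y + z).
have -> : (fun w => U w + V w) @^-1` O = \bigcup_i
    (if `[< good i >] then (U @^-1` B i.1.1 i.2) `&` (V @^-1` B i.1.2 i.2)
     else set0).
  apply/seteqP; split => [w /= Ow|w [i _]]; last first.
    by case: asboolP => // gi [Uw Vw]; exact: gi.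
  have : nbhs (U w + V w) O by exact: open_nbhs_nbhs.
  move=> /nbhs_ballP[r /= r0 rO].
  (* Four distances enter the estimate, each below a radius smaller than [r / 4]. *)
  have r4 : 0 < r / 4 by rewrite divr_gt0.
  have [k ke] := filter_ex (near_infty_natSinv_lt (PosNum r4)).
  have k0 : 0 < k.+1%:R^-1 :> R by rewrite invr_gt0.
  have [m Um] := edense (U w) _ k0; have [n Vn] := edense (V w) _ k0.
  exists ((m, n), k) => //; case: asboolP => [_|[]].
    by split; exact: ball_sym.
  move=> y z /= my nz; apply: rO; move: Um Vn my nz ke.
  rewrite /B -!ball_normE /ball_ /= => Um Vn my nz ke.
  have -> : U w + V w - (y + z) = (U w - e m + (e m - y)) + (V w - e n + (e n - z)).
    by rewrite !subrKA opprD addrACA.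
  have := ler_normD (U w - e m + (e m - y)) (V w - e n + (e n - z)).
  have := ler_normD (U w - e m) (e m - y).
  have := ler_normD (V w - e n) (e n - z).
  by move: (k.+1%:R^-1) Um Vn my nz ke => /= h; lra.
apply: countable_bigcupT_measurable => // i; case: asboolP => // _.
by apply: measurableI; apply: measurable_preimage_open => //; exact: ball_open.
Qed.

Lemma random_element_comp {d' : measure_display} {T' : measurableType d'}
    (h : T' -> T) V : measurable_fun [set: T'] h ->
  random_element V -> random_element (V \o h).
Proof.
by move=> mh mV B mB; have := mh measurableT _ (mV B mB); rewrite setTI.
Qed.

Lemma random_element_sum I (r : seq I) (P : pred I) (V : I -> T -> X) :
  separable X -> (forall i, P i -> random_element (V i)) ->
  random_element (fun w => \sum_(i <- r | P i) V i w).
Proof.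
move=> sX mV; elim: r => [|i r IH].
  by under eq_fun do rewrite big_nil; exact: random_element_cst.
case Pi : (P i); last by under eq_fun do rewrite big_cons Pi.
by under eq_fun do rewrite big_cons Pi; apply: random_elementD => //; exact: mV.
Qed.

End RandomElements.

(** * Symmetrization *)

Section FamilyLaw.
Context {R : realType} {X : normedModType R} {K : finType}.

(** A pi-system that generates the product sigma-algebra on finite families, on which joint laws are
    compared. *)
Definition borel_rectangles : set (set (K -> X)) :=
  [set A | exists2 B : K -> set X, (forall k, <<s open >> (B k)) &
    A = [set x | forall k, B k (x k)]].

Local Notation family_space := (g_sigma_algebraType borel_rectangles).

Lemma borel_rectangles_setI : setI_closed borel_rectangles.
Proof.
move=> _ _ [B mB ->] [C mC ->]; exists (fun k => B k `&` C k).
  move=> k; exact: (@measurableI _ (g_sigma_algebraType (@open X)) _ _ (mB k) (mC k)).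
apply/seteqP; split=> [x [xB xC] k|x xBC]; first by split.
by split=> k; have [] := xBC k.
Qed.

Lemma random_element_coord k :
  random_element (fun x : family_space => (x : K -> X) k).
Proof.
move=> B mB; apply: sub_sigma_algebra.
exists (fun j => if j == k then B else setT) => [j|].
  by case: ifP => // _; exact: (@measurableT _ (g_sigma_algebraType (@open X))).
apply/seteqP; split=> [x Bx j|x /(_ k)]; last by rewrite eqxx.
by case: eqP => [->|].
Qed.

Context {d : measure_display} {T : measurableType d}.

Lemma measurable_family (Z : K -> T -> X) : (forall k, random_element (Z k)) ->
  measurable_fun [set: T] (fun w => (fun k => Z k w) : family_space).
Proof.
move=> mZ; apply: (@measurability _ _ _ family_space _ _ borel_rectangles).
  by [].
move=> _ [_ [B mB ->] <-]; rewrite setTI.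
rewrite [X in measurable X](_ : _ = \bigcap_(k in [set: K]) (Z k @^-1` B k)).
  by apply: fin_bigcap_measurable => // k _; exact: mZ.
by apply/seteqP; split=> [w Bw k _|w Bw k]; exact: Bw.
Qed.

(** The two image measures are finite and agree on a pi-system, hence on the sigma-algebra it
    generates; the integrals are then transported by pushforward. *)
Lemma eq_family_law (mu : probability T R) (Z Z' : K -> T -> X)
    (g : family_space -> \bar R) :
  (forall k, random_element (Z k)) -> (forall k, random_element (Z' k)) ->
  (forall B : K -> set X, (forall k, <<s open >> (B k)) ->
    mu (\bigcap_k (Z k @^-1` B k)) = mu (\bigcap_k (Z' k @^-1` B k))) ->
  measurable_fun [set: family_space] g -> (forall x, 0 <= g x)%E ->
  (\int[mu]_w g (fun k => Z k w) = \int[mu]_w g (fun k => Z' k w))%E.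
Proof.
move=> mZ mZ' ZZ' mg g0.
have push (V : K -> T -> X) : (forall k, random_element (V k)) ->
    exists m : {measure set family_space -> \bar R},
      (forall A, m A = mu ((fun w k => V k w) @^-1` A)) /\
      (\int[mu]_w g (fun k => V k w) = \int[m]_x g x)%E.
  move=> mV; have mf := measurable_family mV.
  exists (measure_function_pushforward__canonical__measure_function_Measure mu mf); split=> //.
  by rewrite ge0_integral_pushforward ?preimage_setT.
have [m [mE ->]] := push _ mZ; have [m' [mE' ->]] := push _ mZ'.
apply: eq_measure_integral => A mA _.
apply: (@measure_unique _ R family_space borel_rectangles (fun=> setT) _
  borel_rectangles_setI _ _ m m') => //.
- by move=> _; exists (fun=> setT) => [k|];
    [exact: (@measurableT _ (g_sigma_algebraType (@open X)))|apply/seteqP].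
- by rewrite bigcup_const//; exists 0%N.
- move=> _ [B mB ->]; rewrite mE mE'.
  have preE (V : K -> T -> X) : (fun w k => V k w) @^-1`
      [set x | forall k, B k (x k)] = \bigcap_k (V k @^-1` B k).
    by apply/seteqP; split=> [w Bw k _|w Bw k]; exact: Bw.
  by rewrite !preE ZZ'.
- by move=> _; rewrite mE preimage_setT probability_setT ltry.
Qed.

End FamilyLaw.

(** * Exchanging two independent copies *)

Section Symmetrization.
Context {R : realType} {X : normedModType R} {d : measure_display}
  {T : measurableType d} (P : probability T R) {K : finType}.
Variable V : K -> T -> X.
Hypothesis sepX : separable X.
Hypothesis mV : forall i, random_element (V i).
Hypothesis iV : independent P V.

Lemma independent_bigcap (B : K -> set X) : (forall i, <<s open >> (B i)) ->
  P (\bigcap_i (V i @^-1` B i)) = (\prod_i P (V i @^-1` B i))%E.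
Proof.
move=> mB; rewrite -big_enum /= -(iV (enum_uniq K)) => [|i _]; last exact: mB.
by congr (P _); apply: eq_bigcapl; split=> i _ //=; rewrite mem_enum.
Qed.

(** The slots [(i, true)] and [(i, false)] hold the two independent copies of [V i]; they are
    exchanged exactly when [s i] is false. *)
Let copy (s : K -> bool) (k : K * bool) (z : T * T) : X :=
  V k.1 (if k.2 == s k.1 then z.1 else z.2).

Let mcopy s k : random_element (copy s k).
Proof.
rewrite /copy; case: eqP => _.
  exact: (random_element_comp measurable_fst (mV k.1)).
exact: (random_element_comp measurable_snd (mV k.1)).
Qed.

(** The right-hand side does not involve [s]: exchanging copies leaves the joint law unchanged. *)
Let copy_law s (B : K * bool -> set X) : (forall k, <<s open >> (B k)) ->
  (P \x P)%E (\bigcap_k (copy s k @^-1` B k)) =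
  (\prod_i (P (V i @^-1` B (i, true)) * P (V i @^-1` B (i, false))))%E.
Proof.
move=> mB.
have -> : \bigcap_k (copy s k @^-1` B k) =
    (\bigcap_i (V i @^-1` B (i, s i))) `*` (\bigcap_i (V i @^-1` B (i, ~~ s i))).
  apply/seteqP; split=> [z zB|z [zB1 zB2] [i b] _].
    split=> i _; first by have := zB (i, s i) I; rewrite /copy /= eqxx.
    by have := zB (i, ~~ s i) I; rewrite /copy /=; case: (s i).
  rewrite /copy /=; case: eqP => [->|bs]; first exact: zB1.
  by have -> : b = ~~ s i; [move: bs; case: b; case: (s i)|exact: zB2].
rewrite product_measure1E; last 2 first.
- by apply: fin_bigcap_measurable => // i _; exact: mV.
- by apply: fin_bigcap_measurable => // i _; exact: mV.
transitivity ((\prod_i P (V i @^-1` B (i, s i))) *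
              \prod_i P (V i @^-1` B (i, ~~ s i)))%E.
  congr (_ * _)%E; first exact: (independent_bigcap (fun i => mB (i, s i))).
  exact: (independent_bigcap (fun i => mB (i, ~~ s i))).
rewrite -big_split /=; apply: eq_bigr => i _.
by case: (s i) => //=; rewrite muleC.
Qed.

(** A sign change of the [i]-th difference is an exchange of the two copies of [V i]. *)
Lemma symmetrized_sign_invariance (p : R) (s : K -> bool) :
  (\int[P \x P]_z (`|\sum_i rsign R (s i) *: (V i z.1 - V i z.2)| `^ p)%:E =
   \int[P \x P]_z (`|\sum_i (V i z.1 - V i z.2)| `^ p)%:E)%E.
Proof.
pose g (x : g_sigma_algebraType (@borel_rectangles R X (K * bool)%type)) : \bar R :=
  (`|\sum_i ((x : K * bool -> X) (i, true) - (x : K * bool -> X) (i, false))| `^ p)%:E.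
have mg : measurable_fun setT g.
  apply/measurable_EFinP; apply: (measurableT_comp (measurable_powR p)).
  apply: (@measurable_continuous_random_element _ _ _ _ (fun x => `|x|)).
    by move=> x; exact: norm_continuous.
  apply: random_element_sum => // i _; apply: random_elementD => //.
    exact: random_element_coord.
  by apply: random_elementN; exact: random_element_coord.
have copyE B mB := etrans (@copy_law s B mB) (esym (@copy_law (fun=> true) B mB)).
rewrite -[RHS](eq_family_law (mcopy s) (mcopy (fun=> true)) copyE mg) => [|x].
  apply: eq_integral => z _; congr ((`|_| `^ p)%:E); apply: eq_bigr => i _.
  by rewrite /copy; case: (s i) => /=; rewrite ?scale1r// scaleN1r opprB.
by rewrite lee_fin powR_ge0.
Qed.

End Symmetrization.

(** * The moment inequality in type-p spaces *)

Section MomentBound.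
Context {R : realType}.

(** Convexity of the power function, obtained from Young's inequality for [h] and [a ^ (p - 1)] with
    exponents [p] and [p / (p - 1)]. The case [p = 1], where the conjugate exponent is infinite, is
    done directly. *)
Lemma powR_tangent (p a h : R) : 1 <= p -> 0 <= a -> 0 <= h ->
  a `^ p + p * a `^ (p - 1) * (h - a) <= h `^ p.
Proof.
move=> p1 a0 h0; have p0 : 0 < p by exact: lt_le_trans p1.
have aE : a `^ p = a `^ (p - 1) * a.
  have [->|an0] := eqVneq a 0; first by rewrite mulr0 powR0 // gt_eqF.
  rewrite -{3}(powRr1 a0) -powRD ?subrK//.
  by rewrite an0 implybT.
move: p1; rewrite le_eqVlt => /predU1P[p1|p1].
  rewrite aE -p1 subrr powRr0 powRr1 //; first by lra.
have p10 : 0 < p - 1 by rewrite subr_gt0.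
have := @conjugate_powR _ h (a `^ (p - 1)) p (p / (p - 1)) h0 (powR_ge0 _ _) p0
  (divr_gt0 p0 p10).
rewrite -powRrM mulrCA divff ?gt_eqF// mulr1 => H.
have {H} : h * a `^ (p - 1) <= h `^ p / p + a `^ p / (p / (p - 1)).
  by apply: H; field; rewrite !gt_eqF.
rewrite -(ler_pM2l p0).
have -> : p * (h `^ p / p + a `^ p / (p / (p - 1))) = h `^ p + (p - 1) * a `^ p.
  by field; rewrite !gt_eqF.
move: (a `^ (p - 1)) aE => b -> ; lra.
Qed.

Lemma powR_normB (V : normedModType R) (p : R) (x y : V) : 0 <= p ->
  `|x - y| `^ p <= 2 `^ p * (`|x| `^ p + `|y| `^ p).
Proof.
move=> p0; wlog xy : x y / `|x| <= `|y|.
  move=> H; have [|/ltW] := leP `|x| `|y|; first exact: H.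
  by rewrite distrC [_ `^ p + _]addrC; exact: H.
apply: le_trans (_ : (2 * `|y|) `^ p <= _).
  apply: ge0_ler_powR => //; rewrite ?nnegrE ?mulr_ge0//.
  by apply: le_trans (ler_normB _ _) _; lra.
by rewrite powRM // ler_pM2l ?powR_gt0// lerDr powR_ge0.
Qed.

Context {X : normedModType R} {d : measure_display} {T : measurableType d}
  (P : probability T R) (p : R).
Hypothesis p1 : 1 <= p.
Hypothesis sepX : separable X.

Let p0 : 0 <= p. Proof. exact: le_trans p1. Qed.

Lemma measurable_norm_powR {d' : measure_display} {T' : measurableType d'}
    (S : T' -> X) : random_element S ->
  measurable_fun [set: T'] (fun w => (`|S w| `^ p)%:E).
Proof.
move=> mS; apply/measurable_EFinP; apply: (measurableT_comp (measurable_powR p)).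
by apply: (measurable_continuous_random_element (g := fun x => `|x|)) => // x;
  exact: norm_continuous.
Qed.

(** Centering expressed by scalar integrals only, a form that passes to finite sums by linearity. *)
Definition weakly_centered (S : T -> X) : Prop := forall f : X -> R, dual_elem f ->
  P.-integrable setT (EFin \o (f \o S)) /\ (\int[P]_w (f (S w))%:E = 0)%E.

Lemma dual_elem0 (f : X -> R) : dual_elem f -> f 0 = 0.
Proof. by move=> [/(_ (-1) 0 0)]; rewrite scaler0 addr0 mulN1r addNr. Qed.

Lemma dual_elemZ (f : X -> R) a x : dual_elem f -> f (a *: x) = a * f x.
Proof.
by move=> df; have [/(_ a x 0)] := df; rewrite addr0 dual_elem0 // addr0.
Qed.

Lemma mean_zero_weakly_centered S : mean_zero P S -> weakly_centered S.
Proof.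
move=> [iS [_ S0]] f df; split; first exact: iS.
by rewrite S0 // dual_elem0.
Qed.

Lemma dual_elem_sum I (r : seq I) (f : X -> R) (x : I -> X) : dual_elem f ->
  f (\sum_(i <- r) x i) = \sum_(i <- r) f (x i).
Proof.
move=> df; have [fl _] := df; elim: r => [|i r IH].
  by rewrite !big_nil dual_elem0.
by rewrite !big_cons -IH -[x i]scale1r fl mul1r scale1r.
Qed.

Lemma weakly_centered_sum I (r : seq I) (V : I -> T -> X) :
  (forall i, weakly_centered (V i)) ->
  weakly_centered (fun w => \sum_(i <- r) V i w).
Proof.
move=> cV f df.
have fE : EFin \o (f \o (fun w => \sum_(i <- r) V i w)) =
    (fun w => \sum_(i <- r) (f (V i w))%:E)%E.
  by apply/funext => w /=; rewrite dual_elem_sum // sumEFin.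
have iV i : P.-integrable setT (fun w => (f (V i w))%:E) by have [] := cV i f df.
split; first by rewrite fE; apply: integrable_sum => // i _; exact: iV.
under eq_integral do rewrite dual_elem_sum // -sumEFin.
rewrite integral_sum //.
by rewrite big1 // => i _; have [] := cV i f df.
Qed.

(* A norming functional f of S w is at most the norm of S w - S w' plus f (S w'),
   and f (S w') averages to zero; the tangent inequality carries this through the
   p-th power. *)
Lemma centered_le_translate (S : T -> X) w : random_element S -> weakly_centered S ->
  ((`|S w| `^ p)%:E <= \int[P]_w' (`|S w - S w'| `^ p)%:E)%E.
Proof.
move=> mS cS.
have [f [df fn fS]] := norming_functional (S w); have [fl fc] := df.
have [iF F0] := cS f df.
have mH : measurable_fun [set: T] (fun w' => (`|S w - S w'| `^ p)%:E).
  apply: measurable_norm_powR; apply: random_elementD => //.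
    exact: random_element_cst.
  exact: random_elementN.
have H0 w' : (0 <= (`|S w - S w'| `^ p)%:E)%E by rewrite lee_fin powR_ge0.
(* An infinite right-hand side leaves nothing to prove. Otherwise its integrand is integrable and
   can be compared with a minorant of variable sign. *)
have [->|Hfin] := eqVneq (\int[P]_w' (`|S w - S w'| `^ p)%:E)%E +oo%E.
  by rewrite leey.
have iH : P.-integrable setT (fun w' => (`|S w - S w'| `^ p)%:E).
  apply/integrableP; split=> //; under eq_integral do rewrite gee0_abs //.
  by rewrite ltey.
pose c := p * `|S w| `^ (p - 1).
have iL : P.-integrable setT (fun w' => (`|S w| `^ p)%:E - c%:E * (f (S w'))%:E)%E.
  apply: integrableB => //; first exact: finite_measure_integrable_cst.
  exact: integrableZl.
have <- : (\int[P]_w' ((`|S w| `^ p)%:E - c%:E * (f (S w'))%:E) = (`|S w| `^ p)%:E)%E.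
  rewrite integralB //; last 2 first.
  - exact: finite_measure_integrable_cst.
  - exact: integrableZl.
  by rewrite integral_cst //= probability_setT mule1 integralZl // F0 mule0 sube0.
apply: le_integral => // w' _; rewrite -EFinM -EFinB lee_fin.
apply: le_trans (powR_tangent p1 (normr_ge0 (S w)) (normr_ge0 _)).
rewrite -/c lerD2l -mulrN ler_wpM2l //.
  by rewrite mulr_ge0 // powR_ge0.
rewrite lerBrDl; apply: le_trans (fn _).
have := fl (-1) (S w') (S w); rewrite scaleN1r mulN1r fS [_ + S w]addrC => ->.
by rewrite addrC.
Qed.

Lemma centered_le_symmetrized (S : T -> X) : random_element S -> weakly_centered S ->
  (pmoment P p S <= \int[P \x P]_z (`|S z.1 - S z.2| `^ p)%:E)%E.
Proof.
move=> mS cS.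
have mSS : measurable_fun [set: T * T] (fun z => (`|S z.1 - S z.2| `^ p)%:E).
  apply: measurable_norm_powR; apply: random_elementD => //.
    exact: (random_element_comp measurable_fst mS).
  exact: (random_elementN (random_element_comp measurable_snd mS)).
rewrite fubini_tonelli1 //.
apply: ge0_le_integral => //.
- exact: measurable_norm_powR.
- by apply: measurable_fun_fubini_tonelli_F => // z; rewrite lee_fin powR_ge0.
- by move=> w _; exact: centered_le_translate.
Qed.

Lemma integral_fst (g : T -> \bar R) : measurable_fun setT g -> (forall w, 0 <= g w)%E ->
  (\int[P \x P]_z g z.1 = \int[P]_w g w)%E.
Proof.
move=> mg g0; rewrite fubini_tonelli1 //.
  apply: eq_integral => w _; rewrite /fubini_F /= integral_cst //=.
  by rewrite probability_setT mule1.
by apply: measurableT_comp => //; exact: measurable_fst.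
Qed.

Lemma integral_snd (g : T -> \bar R) : measurable_fun setT g -> (forall w, 0 <= g w)%E ->
  (\int[P \x P]_z g z.2 = \int[P]_w g w)%E.
Proof.
move=> mg g0; rewrite fubini_tonelli2 //.
  apply: eq_integral => w _; rewrite /fubini_G /= integral_cst //=.
  by rewrite probability_setT mule1.
by apply: measurableT_comp => //; exact: measurable_snd.
Qed.

End MomentBound.

Lemma independent_inj {R : realType} {d : measure_display} {T : measurableType d}
    (P : probability T R) {X : normedModType R} {I J : eqType} (h : J -> I)
    (V : I -> T -> X) : injective h -> independent P V -> independent P (V \o h).
Proof.
move=> hinj iV s B us mB.
(* The sets are carried along [h], with the whole space off the image of [s]; injectivity makes the
   chosen preimage the right one. *)
pose B' i := if pselect (exists2 j, j \in s & h j = i) is left e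
  then B (s2val (cid2 e)) else setT.
have B'E j : j \in s -> B' (h j) = B j.
  move=> js; rewrite /B'; case: pselect => [e|[]]; last by exists j.
  by case: (cid2 e) => /= k _ /hinj ->.
have -> : \bigcap_(j in [set j | j \in s]) ((V \o h) j @^-1` B j) =
    \bigcap_(i in [set i | i \in [seq h j | j <- s]]) (V i @^-1` B' i).
  apply/seteqP; split=> [w Bw _ /= /mapP[j js ->]|w Bw j js].
    by rewrite B'E //; exact: Bw.
  by have := Bw (h j) (map_f h js); rewrite /= B'E.
rewrite iV ?map_inj_uniq // => [|_ /mapP[j js ->]]; last by rewrite B'E //; exact: mB.
by rewrite big_map big_seq [RHS]big_seq; apply: eq_bigr => j js; rewrite B'E.
Qed.

Section TypeMoment.
Context {R : realType} {X : normedModType R} (p : R).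
Hypothesis p1 : 1 <= p.
Hypothesis sepX : separable X.

Let p0 : 0 <= p. Proof. exact: le_trans p1. Qed.

(** Symmetrize, average over all sign patterns, and apply the type inequality pointwise. In the
    constant, [2 ^ p] comes from splitting a difference, the last factor 2 from the two copies, and
    [|C|] guards against a negative [C]. *)
Lemma rademacher_type_moment_ord (C : R) (n : nat) (d : measure_display)
    (T : measurableType d) (P : probability T R) (V : 'I_n -> T -> X) :
  (forall x : 'I_n -> X, (2%:R ^- n) * \sum_(e : {ffun 'I_n -> bool})
        (`| \sum_(j < n) rsign R (e j) *: x j | `^ p)
    <= C * \sum_(j < n) (`| x j | `^ p)) ->
  (forall i, random_element (V i)) -> independent P V ->
  (forall i, weakly_centered P (V i)) ->
  (pmoment P p (fun w => (\sum_i V i w)%R)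
     <= (`|C| * 2 `^ p * 2)%:E * \sum_i pmoment P p (V i))%E.
Proof.
move=> typeC mV iV cV.
have mS : random_element (fun w => \sum_i V i w).
  by apply: random_element_sum => // i _; exact: mV.
apply: le_trans (centered_le_symmetrized p1 sepX mS (weakly_centered_sum _ cV)) _.
pose W i (z : T * T) := V i z.1 - V i z.2.
have mV1 i : random_element (fun z : T * T => V i z.1).
  exact: (random_element_comp measurable_fst (mV i)).
have mV2 i : random_element (fun z : T * T => V i z.2).
  exact: (random_element_comp measurable_snd (mV i)).
have mW i : random_element (W i).
  by apply: random_elementD => //; exact: random_elementN.
have mWe (e : 'I_n -> bool) :
    measurable_fun [set: T * T] (fun z => (`|\sum_i rsign R (e i) *: W i z| `^ p)%:E).
  apply: measurable_norm_powR; apply: random_element_sum => // i _.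
  exact: random_elementZ.
(* All [2 ^ n] sign patterns give the same integral, so their average gives it too. *)
have -> : (\int[P \x P]_z (`|(\sum_i V i z.1 - \sum_i V i z.2)%R| `^ p)%:E =
    \int[P \x P]_z ((2%:R ^- n)%:E * \sum_(e : {ffun 'I_n -> bool})
      (`|(\sum_i rsign R (e i) *: W i z)%R| `^ p)%:E))%E.
  rewrite ge0_integralZl //; last 2 first.
  - by apply: emeasurable_sum => e; exact: mWe.
  - by move=> z _; apply: sume_ge0 => e _; rewrite lee_fin powR_ge0.
  rewrite ge0_integral_sum //.
  under [X in (_ * X)%E]eq_bigr => e _ do
    rewrite (symmetrized_sign_invariance sepX mV iV p e).
  have natmulE m (x : \bar R) : (x *+ m)%R = (m%:R%:E * x)%E by rewrite mule_natl.
  rewrite sumr_const card_ffun card_bool card_ord natmulE muleA -EFinM.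
  rewrite natrX mulVf ?mul1e ?expf_neq0 ?pnatr_eq0 //.
  by apply: eq_integral => z _; rewrite sumrB.
apply: le_trans (_ : _ <= \int[P \x P]_z ((`|C| * 2 `^ p)%:E *
   \sum_i ((`|V i z.1| `^ p)%:E + (`|V i z.2| `^ p)%:E)))%E _.
  apply: ge0_le_integral => //.
  - move=> z _; apply: mule_ge0; first by rewrite lee_fin invr_ge0 exprn_ge0.
    by apply: sume_ge0 => e _; rewrite lee_fin powR_ge0.
  - by apply: measurable_funeM; apply: emeasurable_sum => e.
  - apply: measurable_funeM; apply: emeasurable_sum => i.
    by apply: emeasurable_funD; apply: measurable_norm_powR.
  - move=> z _; rewrite sumEFin -EFinM.
    under [X in (_ <= _ * X)%E]eq_bigr do rewrite -EFinD.
    rewrite sumEFin -EFinM lee_fin; apply: le_trans (typeC (W ^~ z)) _.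
    rewrite -mulrA; apply: le_trans (ler_wpM2r _ (ler_norm C)) _.
      by apply: sumr_ge0 => i _; exact: powR_ge0.
    apply: ler_wpM2l => //; rewrite mulr_sumr; apply: ler_sum => i _.
    exact: powR_normB.
have mVV i : measurable_fun [set: T * T]
    (fun z => (`|V i z.1| `^ p)%:E + (`|V i z.2| `^ p)%:E)%E.
  by apply: emeasurable_funD; apply: measurable_norm_powR.
have VV0 i (z : T * T) : (0 <= (`|V i z.1| `^ p)%:E + (`|V i z.2| `^ p)%:E)%E.
  by rewrite -EFinD lee_fin addr_ge0 ?powR_ge0.
rewrite ge0_integralZl //; last 2 first.
- exact: emeasurable_sum.
- by move=> z _; apply: sume_ge0.
rewrite ge0_integral_sum //.
have double (E : 'I_n -> \bar R) (c : R) :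
    ((c * 2)%:E * \sum_i E i = c%:E * \sum_i (E i + E i))%E.
  by rewrite EFinM -muleA mule_natl mule2n -big_split.
rewrite double.
apply: lee_wpmul2l; first by rewrite lee_fin mulr_ge0 ?powR_ge0.
apply: lee_sum => i _; rewrite ge0_integralD //; last 2 first.
- exact: measurable_norm_powR.
- exact: measurable_norm_powR.
rewrite (integral_fst P (measurable_norm_powR _ (mV i))) => [|w];
  last by rewrite lee_fin powR_ge0.
rewrite (integral_snd P (measurable_norm_powR _ (mV i))) => [|w];
  last by rewrite lee_fin powR_ge0.
by [].
Qed.

(** [K] is chosen before the probability space, the index type and the family, so that one constant
    serves all partial sums. *)
Lemma rademacher_type_moment : rademacher_type X p -> exists2 K : R, 0 <= K &
  forall (d : measure_display) (T : measurableType d) (P : probability T R)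
    (I : finType) (V : I -> T -> X),
  (forall i, random_element (V i)) -> independent P V ->
  (forall i, mean_zero P (V i)) ->
  (pmoment P p (fun w => (\sum_i V i w)%R) <= K%:E * \sum_i pmoment P p (V i))%E.
Proof.
move=> [C typeC]; exists (`|C| * 2 `^ p * 2); first by rewrite !mulr_ge0 ?powR_ge0.
move=> d T P I V mV iV cV.
have reindexE (U : nmodType) (F : I -> U) :
    \sum_i F i = \sum_(k < #|I|) F (enum_val k).
  by rewrite (reindex _ (onW_bij _ (@enum_val_bij I))).
rewrite reindexE; under [X in pmoment _ _ X]eq_fun do rewrite reindexE.
apply: (rademacher_type_moment_ord (typeC #|I|)) => [i||i].
- exact: mV.
- exact: (independent_inj enum_val_inj iV).
- exact: mean_zero_weakly_centered.
Qed.

End TypeMoment.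

(** * Type p implies the convergence of the double series *)

Section WeightedSeries.
Context {R : realType}.

(** Telescoped form of the tail bound for the weights [m ^ -(p + 1)]. With [a = m ^ p] and
    [b = (m + 1) ^ p], the tangent inequality gives [m * (b - a) >= a], and
    [b <= (2 * m) ^ p <= 4 * a] because [p <= 2]. *)
Lemma weight_descent (p : R) (m : nat) : 1 <= p -> p <= 2 -> (0 < m)%N ->
  (m%:R `^ (p + 1))^-1 + 4 * (m.+1%:R `^ p)^-1 <= 4 * (m%:R `^ p)^-1 :> R.
Proof.
move=> p1 p2 m0; have p0 : 0 < p by exact: lt_le_trans p1.
have mR : 0 < m%:R :> R by rewrite ltr0n.
have m1 : 1 <= m%:R :> R by rewrite ler1n.
have aE : m%:R `^ (p - 1) = m%:R `^ p / m%:R :> R.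
  apply: (canRL (mulfK (lt0r_neq0 mR))).
  by rewrite -{2}(powRr1 (ltW mR)) -powRD ?subrK// lt0r_neq0 ?implybT.
rewrite powRD ?lt0r_neq0 ?implybT // (powRr1 (ltW mR)).
have := powR_tangent p1 (ltW mR) (ler0n R m.+1).
rewrite aE -natr1 [_ + 1 - _]addrAC subrr add0r mulr1.
have ub : (m%:R + 1) `^ p <= 4 * m%:R `^ p :> R.
  apply: le_trans (_ : (2 * m%:R) `^ p <= _).
    by apply: ge0_ler_powR; rewrite ?nnegrE; lra.
  rewrite (powRM _ (ler0n R 2) (ltW mR)) ler_pM2r ?powR_gt0//.
  have -> : 4 = 2 `^ 2%:R :> R by rewrite powR_mulrn // expr2; lra.
  by rewrite ler_powR // ler1n.
have a0 : 0 < m%:R `^ p :> R by exact: powR_gt0.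
have b0 : 0 < (m%:R + 1) `^ p :> R by apply: powR_gt0; lra.
move: (m%:R `^ p) ((m%:R + 1) `^ p) a0 b0 ub => a b a0 b0 ub lb.
have {}lb : a + a / m%:R <= b.
  apply: le_trans lb; rewrite lerD2l ler_peMl // divr_ge0 ?(ltW a0) ?(ltW mR)//.
rewrite -subr_ge0.
have -> : 4 * a^-1 - ((a * m%:R)^-1 + 4 * b^-1) =
   (4 * m%:R * (b - a) - b) / (a * m%:R * b) by field; rewrite !gt_eqF.
rewrite divr_ge0 ?mulr_ge0 ?(ltW a0) ?(ltW b0) ?(ltW mR)// subr_ge0; apply: le_trans ub _.
rewrite -mulrA ler_pM2l // mulrC -ler_pdivrMr //; lra.
Qed.

Local Open Scope ereal_scope.

(** Summation by parts: [c m] is dominated by the decrement of [d] at [m]. *)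
Lemma abel_series_le (c d : nat -> R) (g : nat -> \bar R) :
  (forall m, 0 <= c m)%R -> (forall m, 0 <= d m)%R ->
  (forall m, (0 < m)%N -> c m + d m.+1 <= d m)%R -> (forall i, 0 <= g i) ->
  \sum_(1 <= m <oo) ((c m)%:E * \sum_(1 <= i < m.+1) g i) <=
  \sum_(1 <= i <oo) ((d i)%:E * g i).
Proof.
move=> c0 d0 cd g0.
have G0 N : 0 <= \sum_(1 <= i < N) g i by apply: sume_ge0.
(* The boundary term is kept on the left so that the induction closes; it is dropped in the
   limit. *)
have partial N : \sum_(1 <= m < N.+1) ((c m)%:E * \sum_(1 <= i < m.+1) g i) +
    (d N.+1)%:E * \sum_(1 <= i < N.+1) g i <= \sum_(1 <= i < N.+1) ((d i)%:E * g i).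
  elim: N => [|N IH]; first by rewrite !big_geq // mule0 adde0.
  rewrite big_nat_recr //= [leRHS]big_nat_recr //= -addeA.
  apply: le_trans (leeD2r _ IH); rewrite -addeA; apply: leeD2l.
  rewrite -ge0_muleDl ?lee_fin ?c0 ?d0 // -EFinD.
  apply: le_trans (_ : (d N.+1)%:E * \sum_(1 <= i < N.+2) g i <= _).
    by apply: lee_wpmul2r => //; rewrite lee_fin cd.
  by rewrite big_nat_recr //= ge0_muleDr.
apply: lime_le; first by apply: is_cvg_nneseries => n _ _; rewrite mule_ge0 ?lee_fin.
near=> N; have N0 : (0 < N)%N by near: N; exists 1%N.
rewrite -(prednK N0).
apply: le_trans (nneseries_lim_ge N.-1.+1 _); last first.
  by move=> n _ _; rewrite mule_ge0 ?lee_fin.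
apply: le_trans (partial N.-1); rewrite leeDl // mule_ge0 ?lee_fin //.
Unshelve. all: by end_near. Qed.

(** The one-dimensional bound is applied to the column index for each fixed [m], then to the row
    index. *)
Lemma double_abel_series_le (c d : nat -> R) (M : nat -> nat -> \bar R) :
  (forall m, 0 <= c m)%R -> (forall m, 0 <= d m)%R ->
  (forall m, (0 < m)%N -> c m + d m.+1 <= d m)%R -> (forall i j, 0 <= M i j) ->
  \sum_(1 <= m <oo) \sum_(1 <= n <oo)
    ((c m * c n)%:E * \sum_(1 <= i < m.+1) \sum_(1 <= j < n.+1) M i j) <=
  \sum_(1 <= i <oo) \sum_(1 <= j <oo) ((d i * d j)%:E * M i j).
Proof.
move=> c0 d0 cd M0.
have dM0 i j : 0 <= (d j)%:E * M i j by rewrite mule_ge0 ?lee_fin.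
pose g i := \sum_(1 <= j <oo) ((d j)%:E * M i j).
have g0 i : 0 <= g i by exact: nneseries_ge0.
apply: le_trans (_ : _ <= \sum_(1 <= m <oo) ((c m)%:E * \sum_(1 <= i < m.+1) g i)) _.
  apply: lee_nneseries => [m _ _|m _].
    apply: nneseries_ge0 => n _ _; rewrite mule_ge0 ?lee_fin ?mulr_ge0 //.
    by apply: sume_ge0 => i _; apply: sume_ge0.
  rewrite -nneseries_sum_nat //.
  under eq_eseriesr do rewrite EFinM -muleA exchange_big_nat /=.
  have Mm0 j : 0 <= \sum_(1 <= i < m.+1) M i j by apply: sume_ge0.
  rewrite nneseriesZl; last first.
    by move=> n _; rewrite mule_ge0 ?lee_fin //; apply: sume_ge0.
  apply: lee_wpmul2l; first by rewrite lee_fin.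
  apply: le_trans (abel_series_le c0 d0 cd Mm0) _.
  apply: lee_nneseries => [j _ _|j _]; first by rewrite mule_ge0 ?lee_fin.
  by rewrite ge0_sume_distrr.
apply: le_trans (abel_series_le c0 d0 cd g0) _.
apply: lee_nneseries => [i _ _|i _]; first by rewrite mule_ge0 ?lee_fin.
rewrite -nneseriesZl //; apply: lee_nneseries => [j _ _|j _].
  by rewrite mule_ge0 ?lee_fin.
by rewrite muleA -EFinM.
Qed.

End WeightedSeries.

Section Scaling.
Context {R : realType} {X : normedModType R} {d : measure_display}
  {T : measurableType d} (P : probability T R).
Local Open Scope ereal_scope.

Lemma pmoment_ge0 (p : R) (S : T -> X) : 0 <= pmoment P p S.
Proof. by apply: integral_ge0 => w _; rewrite lee_fin powR_ge0. Qed.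

Lemma pmomentZ (p a : R) (S : T -> X) : random_element S ->
  pmoment P p (fun w => a *: S w)%R = (`|a| `^ p)%:E * pmoment P p S.
Proof.
move=> mS; rewrite /pmoment -ge0_integralZl //; last first.
  exact: measurable_norm_powR.
by apply: eq_integral => w _; rewrite normrZ powRM // EFinM.
Qed.

Lemma pmomentB (p : R) (U W : T -> X) : (0 < p)%R -> separable X ->
  random_element U -> random_element W ->
  pmoment P p (fun w => U w - W w)%R <= (2 `^ p)%:E * (pmoment P p U + pmoment P p W).
Proof.
move=> p0 sepX mU mW.
have mUp := measurable_norm_powR p mU; have mWp := measurable_norm_powR p mW.
have UW0 w : 0 <= (`|U w| `^ p)%:E + (`|W w| `^ p)%:E.
  by rewrite -EFinD lee_fin addr_ge0 ?powR_ge0.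
rewrite /pmoment -ge0_integralD // -ge0_integralZl //.
  apply: ge0_le_integral => //.
  - apply: measurable_norm_powR; apply: random_elementD => //.
    exact: random_elementN.
  - by apply: measurable_funeM; exact: emeasurable_funD.
  - by move=> w _; rewrite -EFinD -EFinM lee_fin powR_normB // ltW.
exact: emeasurable_funD.
Qed.

Lemma normalizing_powR (p : R) (m n : nat) : (0 < p)%R ->
  (`|((m * n)%:R `^ ((p + 1) / p))^-1| `^ p =
   (m%:R `^ (p + 1))^-1 * (n%:R `^ (p + 1))^-1 :> R)%R.
Proof.
move=> p0; rewrite ger0_norm ?invr_ge0 ?powR_ge0 // -powRN -powRrM mulNr.
by rewrite divfK ?gt_eqF // powRN natrM powRM // invfM.
Qed.

End Scaling.

Lemma rademacher_type_series (R : realType) (X : normedModType R) (p : R)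
    (d : measure_display) (T : measurableType d) (P : probability T R)
    (V : nat -> nat -> T -> X) :
  1 <= p -> p <= 2 -> separable X -> rademacher_type X p ->
  (forall m n, (0 < m)%N -> (0 < n)%N -> random_element (V m n)) ->
  independent P (fun mn : {mn : nat * nat | (0 < mn.1)%N && (0 < mn.2)%N} =>
                      V (val mn).1 (val mn).2) ->
  (forall m n, (0 < m)%N -> (0 < n)%N -> mean_zero P (V m n)) ->
  (\sum_(1 <= m <oo) \sum_(1 <= n <oo)
        (pmoment P p (V m n) / ((m%:R `^ p) * (n%:R `^ p))%:E) < +oo)%E ->
  (\sum_(1 <= m <oo) \sum_(1 <= n <oo)
        pmoment P p (fun w => ((m * n)%:R `^ ((p + 1) / p))^-1 *:
          (\sum_(1 <= i < m.+1) \sum_(1 <= j < n.+1) V i j w)) < +oo)%E.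
Proof.
move=> p1 p2 sepX typeX mV iV cV.
have p0 : 0 < p by exact: lt_le_trans p1.
have [K K0 KP] := rademacher_type_moment p1 sepX typeX.
pose c m : R := (m%:R `^ (p + 1))^-1.
pose e m : R := 4 * (m%:R `^ p)^-1.
pose M i j := pmoment P p (V i j).
have c0 m : 0 <= c m by rewrite invr_ge0 powR_ge0.
have e0 m : 0 <= e m by rewrite mulr_ge0 // invr_ge0 powR_ge0.
have M0 i j : (0 <= M i j)%E by exact: pmoment_ge0.
have pairE (U : nmodType) (F : nat -> nat -> U) m n :
    \sum_(1 <= i < m.+1) \sum_(1 <= j < n.+1) F i j =
    \sum_(k : 'I_m * 'I_n) F k.1.+1 k.2.+1.
  rewrite big_add1 big_mkord /= -(pair_bigA _ (fun (i : 'I_m) (j : 'I_n) => F i.+1 j.+1)).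
  by apply: eq_bigr => i _; rewrite big_add1 big_mkord.
(* A rectangle of positive indices is an injective image of a finite type, from which it inherits
   independence. *)
pose idx m n (k : 'I_m * 'I_n) : {mn : nat * nat | (0 < mn.1)%N && (0 < mn.2)%N} :=
  exist _ (k.1.+1, k.2.+1) isT.
have idx_inj m n : injective (@idx m n).
  move=> [i j] [i' j'] /(congr1 val) /= [ii' jj'].
  by congr (_, _); apply: val_inj.
have bound m n : (pmoment P p (fun w => ((m * n)%:R `^ ((p + 1) / p))^-1 *:
      (\sum_(1 <= i < m.+1) \sum_(1 <= j < n.+1) V i j w)) <=
    K%:E * ((c m * c n)%:E * \sum_(1 <= i < m.+1) \sum_(1 <= j < n.+1) M i j))%E.
  have SE : (fun w => \sum_(1 <= i < m.+1) \sum_(1 <= j < n.+1) V i j w) =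
      (fun w => \sum_(k : 'I_m * 'I_n) V k.1.+1 k.2.+1 w).
    by apply/funext => w; rewrite pairE.
  rewrite pmomentZ; last first.
    by rewrite SE; apply: random_element_sum => // k _; exact: mV.
  rewrite normalizing_powR // -/(c m) -/(c n) muleCA.
  apply: lee_wpmul2l; first by rewrite lee_fin mulr_ge0.
  rewrite SE pairE; apply: KP => [k||k].
  - exact: mV.
  - exact: (independent_inj (@idx_inj m n) iV).
  - exact: cV.
move=> fin.
have s0 m n : (0 <= (c m * c n)%:E *
    \sum_(1 <= i < m.+1) \sum_(1 <= j < n.+1) M i j)%E.
  rewrite mule_ge0 ?lee_fin ?mulr_ge0 //.
  by apply: sume_ge0 => i _; apply: sume_ge0.
apply: le_lt_trans (_ : _ <= K%:E * \sum_(1 <= m <oo) \sum_(1 <= n <oo)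
   ((c m * c n)%:E * \sum_(1 <= i < m.+1) \sum_(1 <= j < n.+1) M i j))%E _.
  rewrite -nneseriesZl; last by move=> m _; apply: nneseries_ge0.
  apply: lee_nneseries => [m _ _|m _].
    by apply: nneseries_ge0 => n _ _; exact: pmoment_ge0.
  rewrite -nneseriesZl //; apply: lee_nneseries => // n _ _.
  exact: pmoment_ge0.
apply: lte_mul_pinfty => //.
apply: le_lt_trans (double_abel_series_le c0 e0 _ M0) _.
  by move=> m m0; exact: weight_descent.
(* The factor 16 is the product of the two factors 4 in [e m] and [e n]. *)
apply: le_lt_trans (_ : _ <= 16%:E * \sum_(1 <= m <oo) \sum_(1 <= n <oo)
   (M m n / ((m%:R `^ p) * (n%:R `^ p))%:E))%E _; last first.
  by apply: lte_mul_pinfty.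
have t0 m n : (0 <= M m n / ((m%:R `^ p) * (n%:R `^ p))%:E)%E.
  by rewrite mule_ge0 // inve_ge0 lee_fin mulr_ge0 ?powR_ge0.
rewrite -nneseriesZl; last by move=> m _; apply: nneseries_ge0.
apply: lee_nneseries => [m _ _|m _].
  by apply: nneseries_ge0 => n _ _; rewrite mule_ge0 ?lee_fin ?mulr_ge0.
rewrite -nneseriesZl //; apply: lee_nneseries => [n _ _|n _].
  by rewrite mule_ge0 ?lee_fin ?mulr_ge0.
rewrite inver muleCA [leLHS]muleC; apply: lee_wpmul2l => //.
(* The extended inverse of 0 is [+oo], which makes the bound trivial when the denominator
   vanishes. *)
case: eqP => [_|_]; first by rewrite mulry gtr0_sg // mul1e leey.
by rewrite -EFinM lee_fin /e invfM; lra.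
Qed.

(** * A sequence of Rademacher signs *)

Section BinaryDigits.
Context {R : realType}.

(* The i-th binary digit of the position of w inside [a, a + h[. *)
Fixpoint digit (a h : R) (i : nat) (w : R) : bool :=
  if i is j.+1 then
    if a + h / 2 <= w then digit (a + h / 2) (h / 2) j w else digit a (h / 2) j w
  else a + h / 2 <= w.

(** The probability that a fair bit satisfies [g]. Prescribing digits by predicates allows a digit
    to be left free. *)
Definition half_weight (g : bool -> bool) : R := ((g true)%:R + (g false)%:R) / 2.

Definition digit_cell (a h : R) (n : nat) (g : nat -> bool -> bool) : set R :=
  [set w | a <= w < a + h /\ forall i, (i < n)%N -> g i (digit a h i w)].

Lemma digit_cellS (a h : R) n g : 0 < h ->
  digit_cell a h n.+1 g =
    (if g 0%N false then digit_cell a (h / 2) n (fun i => g i.+1) else set0) `|`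
    (if g 0%N true then digit_cell (a + h / 2) (h / 2) n (fun i => g i.+1) else set0).
Proof.
move=> h0; apply/seteqP; split=> [w [/andP[aw wh] gw]|w].
  have [ahw|wah] := leP (a + h / 2) w.
    right; have := gw 0%N isT; rewrite /= ahw => ->; split.
      by rewrite ahw /=; lra.
    by move=> i ni; have := gw i.+1 ni; rewrite /= ahw.
  left; have := gw 0%N isT; rewrite /= leNgt wah /= => ->; split.
    by rewrite aw.
  by move=> i ni; have := gw i.+1 ni; rewrite /= leNgt wah.
move=> [|]; case: ifP => // g0 [/andP[aw wh] gw].
  have wah : (a + h / 2 <= w) = false by rewrite leNgt wh.
  split; first by rewrite aw /=; lra.
  by case=> [_|i ni]; rewrite /= wah //; exact: gw.
split; first by apply/andP; split; lra.
by case=> [_|i ni]; rewrite /= aw //; exact: gw.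
Qed.

(** The first digit selects one or both halves of the interval, and the remaining digits live in a
    half of length [h / 2]. *)
Lemma digit_cell_measure (a h : R) n g : 0 < h ->
  measurable (digit_cell a h n g) /\
  lebesgue_measure (digit_cell a h n g) =
    (h * \prod_(i < n) half_weight (g i))%:E.
Proof.
elim: n a h g => [a h g h0|n IH a h g h0].
  rewrite big_ord0 mulr1 (_ : digit_cell a h 0 g = `[a, a + h[%classic).
    split=> //; rewrite lebesgue_measure_itv /= lte_fin ltrDl h0.
    by rewrite -EFinD addrAC subrr add0r.
  by apply/seteqP; split=> w; rewrite /= in_itv /=; [case|split].
have h20 : 0 < h / 2 by rewrite divr_gt0.
rewrite digit_cellS // big_ord_recl.
have [m0 l0] := IH a (h / 2) (fun i => g i.+1) h20.
have [m1 l1] := IH (a + h / 2) (h / 2) (fun i => g i.+1) h20.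
have mI (c : bool) (A : set R) : measurable A -> measurable (if c then A else set0).
  by case: c.
split; first by apply: measurableU; exact: mI.
have lI (c : bool) (A : set R) (r : R) : lebesgue_measure A = r%:E ->
    lebesgue_measure (if c then A else set0) = (c%:R * r)%:E.
  by case: c => [->|_]; rewrite ?mul1r // mul0r measure0.
rewrite measureU; last 3 first.
- exact: mI.
- exact: mI.
- rewrite -subset0 => w []; case: ifP => // _ [/andP[_ w1] _].
  by case: ifP => // _ [/andP[w2 _] _]; move: (lt_le_trans w1 w2); rewrite ltxx.
rewrite [X in X = _](congr2 (fun x y => x + y)%E (lI _ _ _ l0) (lI _ _ _ l1)).
rewrite -EFinD; congr (_%:E).
rewrite /half_weight /=; lra.
Qed.

Lemma measurable_digit (a h : R) i : measurable (digit a h i @^-1` [set true]).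
Proof.
have mge (x : R) : measurable [set w : R | x <= w].
  rewrite (_ : [set _ | _] = `[x, +oo[%classic) //.
  by apply/seteqP; split=> w; rewrite /= in_itv /= andbT.
elim: i a h => [a h|i IH a h]; first exact: mge.
rewrite (_ : _ @^-1` _ =
    ([set w | a + h / 2 <= w] `&` (digit (a + h / 2) (h / 2) i @^-1` [set true])) `|`
    (~` [set w | a + h / 2 <= w] `&` (digit a (h / 2) i @^-1` [set true]))).
  by apply: measurableU; apply: measurableI => //; exact: measurableC.
apply/seteqP; split=> w /=; first by case: ifP; [left|right].
by case: ifP => [_ [[]|[]]|_ [[]|[]]].
Qed.

Definition unit_uniform : probability (measurableTypeR R) R :=
  uniform_prob (@ltr01 R).

(** Digits of points outside [[0, 1[] carry no meaning, but the uniform law gives that set mass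
    zero, and inside it is Lebesgue measure. *)
Lemma unit_uniform_digit (n : nat) (g : nat -> bool -> bool) :
  unit_uniform [set w | forall i, (i < n)%N -> g i (digit 0 1 i w)] =
  (\prod_(i < n) half_weight (g i))%:E.
Proof.
pose E := [set w | forall i, (i < n)%N -> g i (digit 0 1 i w)].
have mE : measurable E.
  rewrite (_ : E = \bigcap_(i in `I_n) [set w | g i (digit 0 1 i w)]) //.
  apply: fin_bigcap_measurable => // i _.
  rewrite (_ : [set w | _] = (if g i true then digit 0 1 i @^-1` [set true] else set0) `|`
     (if g i false then ~` (digit 0 1 i @^-1` [set true]) else set0)).
    by apply: measurableU; case: ifP => // _; [|apply: measurableC]; exact: measurable_digit.
  apply/seteqP; split=> w /=.
    by case dE : (digit 0 1 i w) => gi; [left|right]; rewrite gi /= dE.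
  move=> [|]; case: ifP => // gi /=; first by move=> ->.
  by move=> /negP/negbTE ->.
have unitE (A : set R) : measurable A -> A `<=` `[0, 1[%classic ->
    unit_uniform A = lebesgue_measure A.
  move=> mA A01; rewrite /unit_uniform /= /uniform_prob.
  rewrite (eq_integral (cst 1%E)); last first.
    move=> x; rewrite inE => /A01; rewrite /= in_itv /= => /andP[x0 x1].
    by rewrite /uniform_pdf x0 (ltW x1) /= subr0 invr1.
  by rewrite integral_cst // mul1e.
have cellE g' : digit_cell 0 1 n g' `<=` `[0, 1[%classic.
  by move=> w [w01 _]; rewrite /= in_itv /= -[X in _ < X]add0r.
have null : unit_uniform (~` `[0, 1[%classic) = 0%E.
  rewrite probability_setC // unitE // lebesgue_measure_itv /= lte_fin ltr01.
  by rewrite oppr0 adde0 subee.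
have [mC lC] := @digit_cell_measure 0 1 n g ltr01.
have CE : E `&` `[0, 1[%classic = digit_cell 0 1 n g.
  rewrite setIC; apply/seteqP; split=> w [].
    by rewrite /= in_itv /= => w01 Ew; split; rewrite // add0r.
  by move=> w01 Ew; split=> //; rewrite /= in_itv /= -[X in _ < X]add0r.
rewrite -/E -(setIT E) -(setUv `[0, 1[%classic) setIUr measureU //; last 3 first.
- exact: measurableI.
- by apply: measurableI => //; exact: measurableC.
- by rewrite setIACA setICr setI0.
rewrite [X in (_ + X)%E](_ : _ = 0%E) ?adde0; last first.
  apply/eqP; rewrite eq_le measure_ge0 andbT -null.
  by apply: le_measure; rewrite ?inE //; [apply: measurableI => //|];
    exact: measurableC.
by rewrite CE; apply: etrans (unitE _ mC (cellE g)) _; rewrite [LHS]lC mul1r.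
Qed.

End BinaryDigits.

(** * Vectors multiplied by fair random signs *)

Section FairSigns.
Context {R : realType} {d : measure_display} {T : measurableType d}
  (P : probability T R) (b : nat -> T -> bool).
Hypothesis mb : forall k, measurable (b k @^-1` [set true]).
Hypothesis fair : forall n (g : nat -> bool -> bool),
  P [set w | forall i, (i < n)%N -> g i (b i w)] =
  (\prod_(i < n) half_weight (R := R) (g i))%:E.

Lemma half_weightT : half_weight (fun=> true) = 1 :> R.
Proof. by rewrite /half_weight /=; lra. Qed.

Lemma half_weight_eq c : half_weight (eq_op^~ c) = 2^-1 :> R.
Proof. by rewrite /half_weight; case: c; rewrite ?eqxx /=; lra. Qed.

(** The indices are enclosed in an initial segment, and the digits outside [s] receive the always
    true predicate, whose weight is 1. *)
Lemma fair_joint (s : seq nat) (g : nat -> bool -> bool) : uniq s ->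
  P [set w | forall i, i \in s -> g i (b i w)] =
  (\prod_(i <- s) half_weight (g i))%:E.
Proof.
move=> us; pose n := (\max_(i <- s) i).+1.
have sn i : i \in s -> (i < n)%N by move=> si; rewrite ltnS; exact: leq_bigmax_seq.
pose g' i : bool -> bool := if i \in s then g i else fun=> true.
rewrite (_ : [set w | _] = [set w | forall i, (i < n)%N -> g' i (b i w)]); last first.
  apply/seteqP; split=> w gw i; first by move=> _; rewrite /g'; case: ifP => // /gw.
  by move=> si; have := gw i (sn i si); rewrite /g' si.
rewrite fair; congr (_%:E).
rewrite -(big_mkord xpredT (fun i => half_weight (g' i))) (bigID (mem s)) /=.
rewrite [X in _ * X]big1 ?mulr1; last first.
  by move=> i /negbTE si; rewrite /g' si half_weightT.
rewrite -big_filter (perm_big s); last first.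
  apply: uniq_perm => //; first by rewrite filter_uniq // iota_uniq.
  move=> i; rewrite mem_filter mem_index_iota /=.
  by case si : (i \in s) => //=; exact: sn.
by rewrite big_seq [RHS]big_seq; apply: eq_bigr => i si; rewrite /g' si.
Qed.

Lemma fair_single k (g : bool -> bool) : P [set w | g (b k w)] = (half_weight g)%:E.
Proof.
have := @fair_joint [:: k] (fun=> g) isT; rewrite big_seq1 => <-.
congr (P _); apply/seteqP; split=> w /=; last by apply; rewrite mem_head.
by move=> gw i; rewrite inE => /eqP ->.
Qed.

Lemma measurable_fair_pred k (g : bool -> bool) : measurable [set w | g (b k w)].
Proof.
rewrite (_ : [set w | _] = (if g true then b k @^-1` [set true] else set0) `|`
     (if g false then ~` (b k @^-1` [set true]) else set0)).
  by apply: measurableU; case: ifP => // _; exact: measurableC.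
apply/seteqP; split=> w /=.
  by case bE : (b k w) => gi; [left|right]; rewrite gi /= bE.
move=> [|]; case: ifP => // gi /=; first by move=> ->.
by move=> /negP/negbTE ->.
Qed.

Lemma fair_law (n : nat) (h : 'I_n -> nat) (F : {ffun 'I_n -> bool} -> R) :
  injective h -> (forall e, 0 <= F e) ->
  (\int[P]_w (F [ffun j => b (h j) w])%:E = (2%:R ^- n * \sum_e F e)%:E)%E.
Proof.
move=> hinj F0.
pose A (e : {ffun 'I_n -> bool}) := [set w | forall j, b (h j) w = e j].
have AE e : A e = \bigcap_(j in [set: 'I_n]) [set w | b (h j) w == e j].
  apply/seteqP; split=> [w Aw j _|w Aw j]; first by rewrite /= Aw.
  by apply/eqP; exact: (Aw j I).
have mA e : measurable (A e).
  rewrite AE; apply: fin_bigcap_measurable => // j _.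
  exact: (measurable_fair_pred (h j) (eq_op^~ (e j))).
have PA e : P (A e) = (2%:R ^- n)%:E.
  (* The pattern [e] is read through [h]; injectivity leaves a single constraint at [h j]. *)
  pose g i c := [forall j, (h j == i) ==> (c == e j)].
  have gE j c : g (h j) c = (c == e j).
    apply/forallP/idP => [/(_ j)|ce j']; first by rewrite eqxx.
    by apply/implyP => /eqP /hinj ->.
  have us : uniq [seq h j | j <- enum 'I_n] by rewrite map_inj_uniq // enum_uniq.
  have := fair_joint g us; rewrite big_map big_enum /=.
  under eq_bigr => j _.
    rewrite (_ : g (h j) = eq_op^~ (e j)) ?half_weight_eq; last first.
      by apply/funext => c; rewrite gE.
    over.
  rewrite prodr_const card_ord exprVn => <-; congr (P _).
  apply/seteqP; split=> [w Aw _ /mapP[j _ ->]|w Aw j]; first by rewrite gE Aw.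
  by have := Aw (h j) (map_f h (mem_enum _ j)); rewrite gE => /eqP.
(* The events [A e] partition the space, so exactly one indicator survives at each [w]. *)
transitivity (\int[P]_w \sum_e ((F e)%:E * (\1_(A e) w)%:E))%E.
  apply: eq_integral => w _; pose e0 := [ffun j => b (h j) w].
  rewrite (bigD1 e0) //= [X in (_ + X)%E]big1 ?adde0.
    rewrite indicE mem_set ?mule1 // => j; by rewrite ffunE.
  move=> e ee0; rewrite indicE memNset ?mule0 // => Ae.
  by move/eqP: ee0; apply; apply/ffunP => j; rewrite ffunE Ae.
rewrite ge0_integral_sum //; last 2 first.
- move=> e; apply: measurable_funeM; apply/measurable_EFinP; exact: measurable_indic.
- by move=> e w _; rewrite mule_ge0 ?lee_fin.
rewrite mulr_sumr -sumEFin; apply: eq_bigr => e _.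
rewrite ge0_integralZl ?lee_fin //; last first.
  by apply/measurable_EFinP; exact: measurable_indic.
by rewrite integral_indic // setIT [X in (_ * X)%E](PA e) -EFinM mulrC.
Qed.

Context {X : normedModType R}.

Definition signed (k : nat) (x : X) (w : T) : X := rsign R (b k w) *: x.

Lemma signed_preimage k x (B : set X) :
  signed k x @^-1` B = [set w | `[< B (rsign R (b k w) *: x) >]].
Proof. by apply/seteqP; split=> w /asboolP. Qed.

Lemma random_element_signed k x : random_element (signed k x).
Proof.
move=> B _; rewrite signed_preimage.
exact: (measurable_fair_pred k (fun c => `[< B (rsign R c *: x) >])).
Qed.

Lemma independent_signed (I : eqType) (h : I -> nat) (x : I -> X) :
  injective h -> independent P (fun i => signed (h i) (x i)).
Proof.
move=> hinj s B us _.
pose g k c := `[< forall i, h i = k -> B i (rsign R c *: x i) >].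
have gE i c : g (h i) c = `[< B i (rsign R c *: x i) >].
  by apply/asboolP/asboolP => [|Bi j /hinj ->//]; exact.
have -> : \bigcap_(i in [set i | i \in s]) (signed (h i) (x i) @^-1` B i) =
    [set w | forall k, k \in map h s -> g k (b k w)].
  apply/seteqP; split=> [w Bw _ /mapP[i si ->]|w gw i si].
    by rewrite gE; apply/asboolP; exact: Bw.
  by apply/asboolP; have := gw (h i) (map_f h si); rewrite gE.
rewrite fair_joint ?map_inj_uniq // big_map -prodEFin; apply: eq_bigr => i _.
rewrite signed_preimage -(fair_single (h i)).
by congr (P _); apply/seteqP; split=> w /=; rewrite gE.
Qed.

(** The sign is a difference of indicators of two events of probability one half. Over [A], the
    Pettis integral is [x] times the scalar integral of the sign. *)
Lemma mean_zero_signed k x : mean_zero P (signed k x).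
Proof.
pose E := [set w | b k w]; pose s w : R := \1_E w - \1_(~` E) w.
have mE : measurable E by exact: measurable_fair_pred k id.
have mCE : measurable (~` E) by exact: measurableC.
have iI (A : set T) : measurable A -> P.-integrable setT (fun w => (\1_A w)%:E).
  by move=> mA; exact: integrable_indic.
have sE w : rsign R (b k w) = s w.
  rewrite /s !indicE in_setC; have [Ew|Ew] := pselect (E w).
    by rewrite mem_set // subr0 (Ew : b k w = true).
  by rewrite memNset // sub0r; move/negP/negbTE: Ew => ->.
have is_ : P.-integrable setT (fun w => (s w)%:E).
  under eq_fun do rewrite EFinB.
  by apply: integrableB => //; exact: iI.
have fE (f : X -> R) w : dual_elem f -> (f (signed k x w))%:E = ((f x)%:E * (s w)%:E)%E.
  by move=> df; rewrite (dual_elemZ _ _ df) sE -EFinM mulrC.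
split; [|split] => [f df|A mA|f df].
- rewrite (_ : EFin \o _ = (fun w => (f x)%:E * (s w)%:E)%E).
    exact: integrableZl.
  by apply/funext => w /=; rewrite fE.
- have isA : P.-integrable A (fun w => (s w)%:E) by exact: integrableS is_.
  have [r rE] : exists r : R, (\int[P]_(w in A) (s w)%:E = r%:E)%E.
    by exists (fine (\int[P]_(w in A) (s w)%:E)); rewrite fineK // integrable_fin_num.
  exists (r *: x) => f df; under eq_integral do rewrite fE //.
  by rewrite integralZl // rE -EFinM (dual_elemZ _ _ df) mulrC.
- under eq_integral do rewrite fE //.
  rewrite integralZl // (_ : (\int[P]_w (s w)%:E) = 0)%E ?mule0.
    by rewrite (dual_elem0 df).
  under eq_integral do rewrite EFinB.
  rewrite integralB //; [|exact: iI|exact: iI].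
  rewrite !integral_indic // !setIT (_ : ~` E = [set w | ~~ b k w]).
    rewrite [X in (X - _)%E](fair_single k id) [X in (_ - X)%E](fair_single k negb).
    rewrite -EFinB /half_weight /=.
    by congr (_%:E); lra.
  by apply/seteqP; split=> w /negP.
Qed.

Lemma pmoment_signed (p : R) k x : pmoment P p (signed k x) = (`|x| `^ p)%:E.
Proof.
rewrite /pmoment /signed; under eq_integral.
  move=> w _; rewrite normrZ (_ : `|rsign R (b k w)| = 1) ?mul1r; last first.
    by rewrite /rsign; case: ifP; rewrite ?normrN normr1.
  over.
by rewrite integral_cst //= probability_setT mule1.
Qed.

Lemma pmoment_signed_sum (p : R) n (h : 'I_n -> nat) (x : 'I_n -> X) : injective h ->
  pmoment P p (fun w => \sum_j signed (h j) (x j) w) =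
  (2%:R ^- n * \sum_(e : {ffun 'I_n -> bool})
     `|\sum_(j < n) rsign R (e j) *: x j| `^ p)%:E.
Proof.
move=> hinj.
have := @fair_law n h (fun e => `|\sum_(j < n) rsign R (e j) *: x j| `^ p) hinj
  (fun e => powR_ge0 _ _).
move=> <-; apply: eq_integral => w _; congr ((`|_| `^ p)%:E).
by apply: eq_bigr => j _; rewrite ffunE.
Qed.

End FairSigns.

(** * Gluing counterexamples *)

Section NotRademacherType.
Context {R : realType} {X : normedModType R} (p : R).
Hypothesis p1 : 1 <= p.

Let p0 : 0 < p. Proof. exact: lt_le_trans p1. Qed.

(** The left side of the type inequality, with vectors indexed by [nat] so that blocks of different
    lengths share one type. *)
Definition rademacher_average (n : nat) (x : nat -> X) : R :=
  2%:R ^- n * \sum_(e : {ffun 'I_n -> bool})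
     `|\sum_(j < n) rsign R (e j) *: x j| `^ p.

Lemma rademacher_averageZ n (a : R) (x : nat -> X) :
  rademacher_average n (fun j => a *: x j) = `|a| `^ p * rademacher_average n x.
Proof.
rewrite /rademacher_average mulrCA; congr (_ * _).
rewrite mulr_sumr; apply: eq_bigr => e _.
rewrite -powRM // -normrZ scaler_sumr; congr (`|_| `^ p).
by apply: eq_bigr => j _; rewrite !scalerA mulrC.
Qed.

Lemma rademacher_type_counterexample (C : R) : ~ rademacher_type X p ->
  exists n : nat, exists2 x : nat -> X,
    \sum_(j < n) `|x j| `^ p = 1 & C < rademacher_average n x.
Proof.
move=> ntype; apply: contrapT => noC; apply: ntype; exists C => n x.
rewrite leNgt; apply/negP => Cx; apply: noC; exists n.
pose x' j := if insub j is Some i then x i else 0.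
have x'E (j : 'I_n) : x' j = x j by rewrite /x' valK.
pose S := \sum_(j < n) `|x' j| `^ p.
have SE : S = \sum_(j < n) `|x j| `^ p by apply: eq_bigr => j _; rewrite x'E.
have avgE : rademacher_average n x' = 2 ^- n * \sum_(e : {ffun 'I_n -> bool})
    `|\sum_(j < n) rsign R (e j) *: x j| `^ p.
  congr (_ * _); apply: eq_bigr => e _; congr (`|_| `^ p).
  by apply: eq_bigr => j _; rewrite x'E.
rewrite -SE -avgE in Cx.
have S_ge0 : 0 <= S by apply: sumr_ge0 => j _; exact: powR_ge0.
(* If [S = 0], all the vectors vanish and the inequality assumed violated reads [0 <= 0]. *)
have S0 : 0 < S.
  rewrite lt_neqAle S_ge0 andbT eq_sym; apply/eqP => S0.
  move: Cx; rewrite S0 mulr0 ltNge => /negP; apply.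
  rewrite /rademacher_average big1 ?mulr0 // => e _.
  rewrite big1 ?normr0 ?powR0 ?gt_eqF // => j _.
  have /eqP := S0; rewrite psumr_eq0 => [|i _]; last exact: powR_ge0.
  move=> /allP /(_ j (mem_index_enum _)) /=.
  by rewrite powR_eq0 normr_eq0 => /andP[/eqP -> _]; rewrite scaler0.
(* Both sides are homogeneous of degree [p], so this factor normalizes the power sum to 1. *)
pose a := S `^ (- p^-1).
have aE : `|a| `^ p = S^-1.
  rewrite ger0_norm ?powR_ge0 // -powRrM mulNr mulVf ?gt_eqF //.
  by rewrite powR_inv1 // ltW.
exists (fun j => a *: x' j).
  under eq_bigr do rewrite normrZ powRM // aE.
  by rewrite -mulr_sumr mulVf // gt_eqF.
by rewrite rademacher_averageZ aE mulrC ltr_pdivlMr.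
Qed.

End NotRademacherType.

(** * Sparse blocks along a sequence *)

Section Blocks.
Variables n N : nat -> nat.
Hypothesis nN : forall k, (n k <= N k)%N.
Hypothesis N0 : forall k, (0 < N k)%N.
Hypothesis gapN : forall k l, (k < l)%N -> (4 * N k <= N l)%N.

Definition in_block (k i : nat) : bool := (N k < i <= N k + n k)%N.

Lemma in_block_inj i k l : in_block k i -> in_block l i -> k = l.
Proof.
rewrite /in_block => ki li; have := nN k; have := nN l.
by have [/gapN|/gapN|->//] := ltngtP k l; lia.
Qed.

Context {R : realType} {X : normedModType R}.
Variable z : nat -> nat -> X.

(** If no block contains [i], [xget] returns its default 0 and the membership test fails. Block [k]
    starts at [(N k).+1]. *)
Definition glue (i : nat) : X :=
  let k := xget 0%N [set k | in_block k i] in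
  if in_block k i then z k (i - (N k).+1) else 0.

Lemma glue_block k j : (j < n k)%N -> glue (N k + j.+1) = z k j.
Proof.
move=> jn; have kj : in_block k (N k + j.+1) by rewrite /in_block; lia.
rewrite /glue; case: xgetP => [l _ /= lj|/(_ k)//].
rewrite lj (in_block_inj lj kj); congr z; lia.
Qed.

Lemma glue_out i : (forall k, ~~ in_block k i) -> glue i = 0.
Proof. by move=> out; rewrite /glue (negbTE (out _)). Qed.

(** Block [k] ends by [2 * N k] because [n k <= N k], and the next one starts after [4 * N k]. *)
Lemma glue_after k i : (2 * N k < i <= 4 * N k)%N -> glue i = 0.
Proof.
move=> ik; apply: glue_out => l; apply/negP; rewrite /in_block => il.
have := nN l; have [/gapN|/gapN|lk] := ltngtP l k; [lia|lia|].
by move: ik il; rewrite lk; lia.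
Qed.

(** An earlier block [l] ends by [2 * N l], which is at most half of [N k]. *)
Lemma glue_before k i : (N k < 2 * i)%N -> (i <= N k)%N -> glue i = 0.
Proof.
move=> ki ik; apply: glue_out => l; apply/negP; rewrite /in_block => il.
have := nN l; have [/gapN|/gapN|lk] := ltngtP l k; [lia|lia|].
by move: ik il; rewrite lk; lia.
Qed.

Lemma glue_between k i : (N k + n k < i <= N k.+1)%N -> glue i = 0.
Proof.
move=> ki; apply: glue_out => l; apply/negP; rewrite /in_block => il.
have := nN l; have := nN k; have [/gapN|kl|lk] := ltngtP l k; [lia| |].
  move: kl; rewrite leq_eqVlt => /predU1P[kl|/gapN]; last lia.
  by move: il; rewrite -kl; lia.
by move: ki il; rewrite lk; lia.
Qed.

Lemma glue_first i : (i <= N 0)%N -> glue i = 0.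
Proof.
move=> iN; apply: glue_out => l; apply/negP; rewrite /in_block => il.
by case: l il => [|l]; [lia|have := gapN (ltn0Sn l); have := N0 l.+1; lia].
Qed.

(** A general [F] lets one statement serve both the weighted power sums and the signed sums. *)
Lemma glue_sum_block k (U : nmodType) (F : nat -> X -> U) :
  (forall i, F i 0 = 0) ->
  \sum_((N k).+1 <= i < (N k.+1).+1) F i (glue i) =
  \sum_(j < n k) F (N k + j.+1)%N (z k j).
Proof.
move=> F0; have := gapN (ltnSn k); have := nN k => nk Nk.
rewrite (big_cat_nat _ (n := (N k + n k).+1)) /=; [|lia|lia].
rewrite [X in _ + X]big_nat_cond [X in _ + X]big1 ?addr0; last first.
  by move=> i /andP[/andP[ki ik] _]; rewrite (@glue_between k) ?F0 //; lia.
rewrite -[X in index_iota X]add0n -addSn -[X in index_iota _ X]addnC.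
rewrite big_addn addnK big_mkord; apply: eq_bigr => j _.
by rewrite addnC addSnnS glue_block.
Qed.

End Blocks.

(** Powers of 4 with strictly increasing exponents give the gaps; including the block lengths in the
    exponents gives [n k <= N k]. The half [L k] marks the start of the window before block [k]. *)
Lemma block_positions (n : nat -> nat) : exists N L : nat -> nat,
  [/\ forall k, (n k <= N k)%N, forall k, N k = (2 * L k)%N, forall k, (0 < L k)%N
    & forall k l, (k < l)%N -> (4 * N k <= N l)%N].
Proof.
pose e k := (k + \sum_(j < k.+1) n j)%N.
have e_lt k l : (k < l)%N -> (e k < e l)%N.
  apply: (homo_ltn (r := fun a b => (a < b)%N)) => [b a c|i]; first exact: ltn_trans.
  by rewrite /e [in X in (_ < X)%N]big_ord_recr /=; lia.
exists (fun k => 4 ^ (e k).+1)%N, (fun k => 2 * 4 ^ e k)%N; split=> [k|k|k|k l kl].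
- apply: leq_trans (_ : (e k).+1 <= _)%N; last by rewrite ltnW // ltn_expl.
  by rewrite /e big_ord_recr /=; lia.
- by rewrite expnS; lia.
- by rewrite muln_gt0 expn_gt0.
- by rewrite -expnS leq_pexp2l // ltnS e_lt.
Qed.

Section SeriesBounds.
Context {R : realType}.
Local Open Scope ereal_scope.

Lemma nneseries_le_bound (f : nat -> \bar R) (B : \bar R) : (forall n, 0 <= f n) ->
  (forall M, \sum_(1 <= i < M) f i <= B) -> \sum_(1 <= i <oo) f i <= B.
Proof.
move=> f0 fB; apply: lime_le; first exact: is_cvg_nneseries.
by near=> M; exact: fB.
Unshelve. all: by end_near. Qed.

Lemma nneseries_first (f : nat -> \bar R) : 0 <= f 1%N ->
  (forall n, (1 < n)%N -> f n = 0) -> \sum_(1 <= i <oo) f i = f 1%N.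
Proof.
move=> f1 f0; apply: lim_near_cst => //; near=> M.
have M1 : (1 < M)%N by near: M; exists 2%N.
rewrite big_ltn // big_nat_cond big1 ?adde0 // => i /andP[/andP[i1 _] _].
exact: f0.
Unshelve. all: by end_near. Qed.

(** The window contributes [A] equal values, each with weight at least [(2 * A) ^ -(p + 1)]. *)
Lemma constant_window_le (p : R) (E : nat -> \bar R) (A : nat) (Q : R) :
  (1 <= p)%R -> (0 < A)%N -> (forall m, 0 <= E m) ->
  (forall m, (A <= m < 2 * A)%N -> E m = E A) ->
  \sum_(1 <= m <oo) ((m%:R `^ (p + 1))^-1%:E * E m) <= Q%:E ->
  E A <= (2 `^ (p + 1) * A%:R `^ p * Q)%:E.
Proof.
move=> p1 A0 E0 EA EQ.
have AR : (0 < A%:R :> R)%R by rewrite ltr0n.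
pose K : R := ((2 * A)%:R `^ (p + 1))%R.
have K0 : (0 < K)%R by rewrite powR_gt0 // ltr0n; lia.
have p10 : (0 <= p + 1)%R by lra.
have t0 m : 0 <= (m%:R `^ (p + 1))^-1%:E * E m.
  by rewrite mule_ge0 // lee_fin invr_ge0 powR_ge0.
have : (A%:R * K^-1)%:E * E A <= Q%:E.
  apply: le_trans EQ; apply: le_trans (nneseries_lim_ge (2 * A)%N _); last by [].
  rewrite (big_cat_nat _ (n := A)) /=; [|lia|lia].
  apply: le_trans (leeDr _ _); last by apply: sume_ge0.
  apply: le_trans (_ : \sum_(A <= m < 2 * A) (K^-1%:E * E A) <= _).
    have natmulE k (x : \bar R) : (x *+ k)%R = k%:R%:E * x by rewrite mule_natl.
    by rewrite sumr_const_nat natmulE (_ : (2 * A - A = A)%N) ?EFinM ?muleA //; lia.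
  rewrite big_seq [leRHS]big_seq; apply: lee_sum => m; rewrite mem_index_iota => mA.
  rewrite (EA m mA); apply: lee_wpmul2r => //; rewrite lee_fin.
  rewrite lef_pV2 ?posrE ?powR_gt0 ?ltr0n //; [|lia|lia].
  by apply: ge0_ler_powR; rewrite ?nnegrE // ler_nat; lia.
have AK0 : (0 < A%:R * K^-1)%R by rewrite divr_gt0.
move=> H; have {H} : E A <= ((A%:R * K^-1)^-1)%:E * Q%:E by rewrite lee_pdivlMl.
rewrite -EFinM => /le_trans; apply.
rewrite lee_fin le_eqVlt; apply/orP; left; apply/eqP.
rewrite /K natrM powRM // [(A%:R `^ (p + 1))%R]powRD ?lt0r_neq0 ?implybT //.
rewrite (powRr1 (ltW AR)); field.
by rewrite !gt_eqF // powR_gt0.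
Qed.

End SeriesBounds.

(** * From the double series to type p *)

Lemma series_rademacher_type (R : realType) (X : completeNormedModType R) (p : R) :
  1 <= p ->
  (forall (d : measure_display) (T : measurableType d) (P : probability T R)
          (V : nat -> nat -> T -> X),
     (forall m n, (0 < m)%N -> (0 < n)%N -> random_element (V m n)) ->
     independent P (fun mn : {mn : nat * nat | (0 < mn.1)%N && (0 < mn.2)%N} =>
                      V (val mn).1 (val mn).2) ->
     (forall m n, (0 < m)%N -> (0 < n)%N -> mean_zero P (V m n)) ->
     (\sum_(1 <= m <oo) \sum_(1 <= n <oo)
        (pmoment P p (V m n) / ((m%:R `^ p) * (n%:R `^ p))%:E) < +oo)%E ->
     (\sum_(1 <= m <oo) \sum_(1 <= n <oo)
        pmoment P p (fun w => ((m * n)%:R `^ ((p + 1) / p))^-1 *: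
          (\sum_(1 <= i < m.+1) \sum_(1 <= j < n.+1) V i j w)) < +oo)%E) ->
  separable X -> rademacher_type X p.
Proof.
move=> p1 series sepX; apply: contrapT => ntype.
have p0 : 0 < p by exact: lt_le_trans p1.
have [nx nxP] := choice (fun k : nat => let: ex_intro n (ex_intro2 x h1 h2) :=
  rademacher_type_counterexample p1 (4 ^+ k) ntype in
  ex_intro (fun nx : nat * (nat -> X) => \sum_(j < nx.1) `|nx.2 j| `^ p = 1 /\
    4 ^+ k < rademacher_average p nx.1 nx.2) (n, x) (conj h1 h2)).
pose n k := (nx k).1; pose x k := (nx k).2.
have [N [L [nN NL L0 gapN]]] := block_positions n.
have N0 k : (0 < N k)%N by rewrite NL; have := L0 k; lia.
have NR k : 0 < (N k)%:R :> R by rewrite ltr0n.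
(* Scaling by [a k] turns the normalized power sum 1 of block [k] into [2 ^- k * N k ^ p]. *)
pose a k : R := (2 ^- k) `^ p^-1 * (N k)%:R.
have a0 k : 0 <= a k by rewrite mulr_ge0 // powR_ge0.
have aE k : `|a k| `^ p = 2 ^- k * (N k)%:R `^ p.
  have k2 : 0 <= 2 ^- k :> R by rewrite invr_ge0 exprn_ge0.
  by rewrite ger0_norm // powRM ?powR_ge0 // -powRrM mulVf ?gt_eqF // powRr1.
pose y := glue n N (fun k j => a k *: x k j).
pose b (k : nat) (w : measurableTypeR R) : bool := digit 0 1 k w.
pose P := @unit_uniform R.
have mb k : measurable (b k @^-1` [set true] : set (measurableTypeR R)) by exact: measurable_digit.
have fair m (g : nat -> bool -> bool) :
    P [set w | forall i, (i < m)%N -> g i (b i w)] = (\prod_(i < m) half_weight (g i))%:E.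
  exact: unit_uniform_digit.
(* Only the first column is nonzero; [pickle] assigns every position a digit of its own. *)
pose V (m n : nat) : measurableTypeR R -> X :=
  signed b (pickle (m, n)) (if n == 1%N then y m else 0).
pose u i : R := `|y i| `^ p / i%:R `^ p.
have u0 i : 0 <= u i by rewrite divr_ge0 ?powR_ge0.
(* Positions in block [k] exceed [N k], so dividing by [i ^ p] cancels the factor [N k ^ p]. *)
have u_block k : \sum_((N k).+1 <= i < (N k.+1).+1) u i <= 2 ^- k.
  pose F i (v : X) : R := `|v| `^ p / i%:R `^ p.
  have F0 i : F i 0 = 0 by rewrite /F normr0 powR0 ?gt_eqF // mul0r.
  rewrite (glue_sum_block nN gapN (fun k j => a k *: x k j) k F0).
  have [x1 _] := nxP k.
  apply: le_trans (_ : \sum_(j < n k) (2 ^- k * `|x k j| `^ p) <= _); last first.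
    by rewrite -mulr_sumr x1 mulr1.
  apply: ler_sum => j _; rewrite /F normrZ powRM // aE.
  rewrite mulrAC ler_wpM2r ?powR_ge0 // ler_pdivrMr ?powR_gt0 ?ltr0n ?addnS //.
  rewrite ler_wpM2l ?invr_ge0 ?exprn_ge0 //.
  by apply: ge0_ler_powR; rewrite ?nnegrE ?ler0n ?ler_nat ?(ltW p0) //; lia.
(* The bound is the geometric sum of [2 ^- j] over [j < k]. *)
have u_sum k : \sum_(1 <= i < (N k).+1) u i <= 2 * (1 - 2 ^- k).
  elim: k => [|k IH].
    rewrite expr0 invr1 subrr mulr0 big_nat_cond big1 // => i /andP[/andP[_ iN] _].
    by rewrite /u /y (glue_first n N0 gapN) // normr0 powR0 ?gt_eqF // mul0r.
  rewrite (big_cat_nat _ (n := (N k).+1)) //=; last by have := gapN _ _ (ltnSn k); lia.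
  apply: le_trans (lerD IH (u_block k)) _.
  by rewrite exprS invfM; lra.
have kN k : (k <= N k)%N.
  by elim: k => [//|k IH]; have := gapN _ _ (ltnSn k); have := N0 k; lia.
have mV i j : random_element (V i j) by exact: random_element_signed.
have indV : independent P (fun mn : {mn : nat * nat | (0 < mn.1)%N && (0 < mn.2)%N} =>
    V (val mn).1 (val mn).2).
  pose h (mn : {mn : nat * nat | (0 < mn.1)%N && (0 < mn.2)%N}) : nat :=
    pickle ((val mn).1, (val mn).2).
  have h_inj : injective h.
    move=> [[i j] ij] [[i' j'] ij'] /(pcan_inj pickleK) /= [ii jj].
    by apply: val_inj; rewrite /= ii jj.
  exact: (independent_signed fair
    (fun mn : {mn : nat * nat | (0 < mn.1)%N && (0 < mn.2)%N} =>
       if (val mn).2 == 1%N then y (val mn).1 else 0) h_inj).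
have V0 i j : (0 <= pmoment P p (V i j) / ((i%:R `^ p) * (j%:R `^ p))%:E)%E.
  by rewrite mule_ge0 ?pmoment_ge0 // inve_ge0 lee_fin mulr_ge0 ?powR_ge0.
have inner m : (0 < m)%N -> (\sum_(1 <= n <oo)
    (pmoment P p (V m n) / ((m%:R `^ p) * (n%:R `^ p))%:E) = (u m)%:E)%E.
  move=> m0; rewrite nneseries_first //.
    rewrite pmoment_signed /= powR1 mulr1 inver gt_eqF //.
    by rewrite powR_gt0 // ltr0n.
  move=> j j1; rewrite pmoment_signed (gtn_eqF j1) normr0 powR0 ?mul0e //.
  by rewrite gt_eqF.
have := series _ _ P V (fun m n _ _ => mV m n) indV
  (fun m n _ _ => mean_zero_signed mb fair _ _).
have -> : (\sum_(1 <= m <oo) \sum_(1 <= n <oo)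
        (pmoment P p (V m n) / ((m%:R `^ p) * (n%:R `^ p))%:E) < +oo)%E.
  apply: le_lt_trans (ltry 2); apply: nneseries_le_bound => [m|M].
    exact: nneseries_ge0.
  rewrite big_seq (eq_bigr (fun m => (u m)%:E)); last first.
    by move=> m; rewrite mem_index_iota => /andP[m0 _]; exact: inner.
  rewrite -big_seq sumEFin lee_fin.
  apply: le_trans (_ : \sum_(1 <= m < (N M).+1) u m <= _).
    case: M => [|M]; first by rewrite big_geq // sumr_ge0.
    rewrite [leRHS](big_cat_nat _ (n := M.+1)) //=; last by rewrite ltnW // ltnS kN.
    by rewrite lerDl sumr_ge0.
  apply: le_trans (u_sum M) _.
  have : 0 <= 2 ^- M :> R by rewrite invr_ge0 exprn_ge0.
  by lra.
move=> /(_ isT) finite.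
pose G m w := \sum_(1 <= i < m.+1) V i 1%N w.
have mG m : random_element (G m) by apply: random_element_sum.
have G_const A m : (A <= m)%N -> (forall i, (A < i <= m)%N -> y i = 0) -> G m = G A.
  move=> Am yA; apply/funext => w; rewrite /G (big_cat_nat _ (n := A.+1)) //=.
  rewrite [X in _ + X]big_nat_cond [X in _ + X]big1 ?addr0 // => i /andP[iA _].
  by rewrite /V /signed eqxx yA ?scaler0.
pose E m := pmoment P p (G m).
have E0 m : (0 <= E m)%E by exact: pmoment_ge0.
have [q q0 qE] : exists2 q : R, 0 <= q &
    (\sum_(1 <= m <oo) ((m%:R `^ (p + 1))^-1%:E * E m) <= q%:E)%E.
  set Z := (X in (X < +oo)%E) in finite.
  have Z0 : (0 <= Z)%E.
    by apply: nneseries_ge0 => m _ _; apply: nneseries_ge0 => j _ _; exact: pmoment_ge0.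
  exists (fine Z); first exact: fine_ge0.
  rewrite fineK ?ge0_fin_numE //; apply: lee_nneseries => [m _ _|m _].
    by rewrite mule_ge0 // lee_fin invr_ge0 powR_ge0.
  (* Of each inner series only the term of the first column is kept. *)
  apply: le_trans (nneseries_lim_ge 2 _); last by move=> j _ _; exact: pmoment_ge0.
  rewrite big_nat1; under [X in pmoment _ _ X]eq_fun do
    (under eq_bigr do rewrite big_nat1).
  by rewrite (pmomentZ _ _ _ (mG m)) normalizing_powR // powR1 invr1 mulr1.
have window A : (0 < A)%N -> (forall m, (A <= m < 2 * A)%N -> G m = G A) ->
    (E A <= (2 `^ (p + 1) * A%:R `^ p * q)%:E)%E.
  move=> A0 GA; have EA m : (A <= m < 2 * A)%N -> E m = E A.
    by move=> mA; rewrite /E GA.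
  exact: (constant_window_le p1 A0 E0 EA qE).
(* Block [k] is a difference of two column sums. On the right, [2 ^ p] comes from splitting it,
   [2 ^ (p + 1)] from the windows, and [2 ^ p + 1] from their starts [2 * N k] and [L k <= N k]. On
   the left, the violation [4 ^ k] outweighs the scaling [2 ^- k]. *)
have growth k : 2 ^+ k <= 2 `^ p * (2 `^ (p + 1) * (2 `^ p + 1) * q).
  have Nk : (2 * N k <= N k.+1)%N by have := gapN _ _ (ltnSn k); lia.
  have G2N : G (N k.+1) = G (2 * N k)%N.
    apply: G_const => // i iN; rewrite /y (glue_between nN gapN _ (k := k)) //.
    by have := nN k; lia.
  have GL : G (N k) = G (L k).
    apply: G_const => [|i iN]; first by rewrite NL; have := L0 k; lia.
    by rewrite /y (glue_before nN gapN _ (k := k)) //; move: iN; rewrite NL; lia.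
  have EL : (E (L k) <= (2 `^ (p + 1) * (L k)%:R `^ p * q)%:E)%E.
    apply: window => // m mL; apply: G_const => [|i iL]; first by case/andP: mL.
    by rewrite /y (glue_before nN gapN _ (k := k)) // NL; lia.
  have E2N : (E (2 * N k)%N <= (2 `^ (p + 1) * (2 * N k)%:R `^ p * q)%:E)%E.
    apply: window => [|m mN]; first by have := N0 k; lia.
    apply: G_const => [|i iN]; first by case/andP: mN.
    by rewrite /y (glue_after nN gapN _ (k := k)) //; lia.
  pose h (j : 'I_(n k)) : nat := pickle ((N k + j.+1)%N, 1%N).
  have h_inj : injective h.
    by move=> i j /(pcan_inj pickleK) [] ij; apply: val_inj => /=; lia.
  pose F (w : measurableTypeR R) (i : nat) (v : X) : X := signed b (pickle (i, 1%N)) v w.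
  have F0 w i : F w i 0 = 0 by rewrite /F /signed scaler0.
  have blockE w : \sum_(j < n k) signed b (h j) (a k *: x k j) w =
      G (2 * N k)%N w - G (L k) w.
    rewrite -G2N -GL /G [in RHS](big_cat_nat _ (n := (N k).+1)) //=; last lia.
    rewrite addrAC subrr add0r.
    by have := glue_sum_block nN gapN (fun k j => a k *: x k j) k (F0 w) => <-.
  have := pmoment_signed_sum mb fair p (fun j : 'I_(n k) => a k *: x k j) h_inj.
  rewrite (eq_fun blockE) -/(rademacher_average p (n k) (fun j => a k *: x k j)).
  rewrite rademacher_averageZ aE => block.
  have := pmomentB P p0 sepX (mG (2 * N k)%N) (mG (L k)); rewrite block.
  have [_ x4] := nxP k.
  move=> /le_trans H.
  have {}H : ((2 ^- k * (N k)%:R `^ p * rademacher_average p (n k) (x k))%:E <=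
     (2 `^ p)%:E * ((2 `^ (p + 1) * (2 * N k)%:R `^ p * q)%:E +
       (2 `^ (p + 1) * (L k)%:R `^ p * q)%:E))%E.
    by apply: H; apply: lee_wpmul2l; [rewrite lee_fin powR_ge0|exact: leeD].
  rewrite -EFinD -EFinM lee_fin in H.
  have Np0 : 0 < (N k)%:R `^ p :> R by exact: powR_gt0.
  have LN : (L k)%:R `^ p <= (N k)%:R `^ p :> R.
    apply: (ge0_ler_powR (ltW p0)); rewrite ?nnegrE ?ler0n // ler_nat NL.
    exact: leq_pmull.
  rewrite -(ler_pM2r Np0); apply: le_trans (_ : 2 ^- k * (N k)%:R `^ p * 4 ^+ k <= _).
    rewrite mulrAC ler_pM2r // (_ : 4 = 2 * 2 :> R); last by lra.
    by rewrite exprMn mulKf // expf_neq0.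
  apply: le_trans (_ : 2 ^- k * (N k)%:R `^ p * rademacher_average p (n k) (x k) <= _).
    by rewrite ler_pM2l ?(ltW x4) // mulr_gt0 // invr_gt0 exprn_gt0.
  apply: le_trans H _; rewrite natrM powRM //.
  move: (powR_ge0 2 p) (powR_ge0 2 (p + 1)) LN; clear -q0.
  move: (2 `^ p) (2 `^ (p + 1)) ((N k)%:R `^ p) ((L k)%:R `^ p) => r c s t r0 c0 ts.
  by have := ler_wpM2l (mulr_ge0 (mulr_ge0 r0 c0) q0) ts; lra.
pose D : R := 2 `^ p * (2 `^ (p + 1) * (2 `^ p + 1) * q).
have D0 : 0 <= D by rewrite !mulr_ge0 ?addr_ge0 ?powR_ge0.
(* At [k = Num.bound D] one has [D < k < 2 ^ k], against [growth]. *)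
have := growth (Num.bound D); rewrite leNgt => /negP; apply.
apply: lt_trans (archi_boundP D0) _.
by rewrite -natrX ltr_nat ltn_expl.
Qed.

Theorem theorem3p1 (R : realType) (X : completeNormedModType R) (p : R)
  (hp1 : 1 <= p) (hp2 : p <= 2) (hsep : separable X) :
  rademacher_type X p <->
  (forall (d : measure_display) (T : measurableType d) (P : probability T R)
          (V : nat -> nat -> T -> X),
     (forall m n, (0 < m)%N -> (0 < n)%N -> random_element (V m n)) ->
     independent P (fun mn : {mn : nat * nat | (0 < mn.1)%N && (0 < mn.2)%N} =>
                      V (val mn).1 (val mn).2) ->
     (forall m n, (0 < m)%N -> (0 < n)%N -> mean_zero P (V m n)) ->
     (\sum_(1 <= m <oo) \sum_(1 <= n <oo)
        (pmoment P p (V m n) / ((m%:R `^ p) * (n%:R `^ p))%:E) < +oo)%E ->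
     (\sum_(1 <= m <oo) \sum_(1 <= n <oo)
        pmoment P p (fun w => ((m * n)%:R `^ ((p + 1) / p))^-1 *:
          (\sum_(1 <= i < m.+1) \sum_(1 <= j < n.+1) V i j w)) < +oo)%E).
Proof.
split=> [typeX d T P V mV iV cV|series]; first exact: rademacher_type_series.
exact: series_rademacher_type.
Qed.
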